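(* Let $K$ be any field. The Lie superalgebra $\mathbf Q=\mathrm{Lie}(v_0,v_1,v_2)$ is just infinite, i.e. it is infinite-dimensional and every nonzero ideal of $\mathbf Q$ has finite codimension in $\mathbf Q$.
   Context: $\Lambda$ is the Grassmann algebra over $K$ on odd generators $x_0,x_1,\dots$; $x_i$ is identified with left multiplication; $\partial_i$ is the odd superderivation with $\partial_i(x_j)=\delta_{ij}$; pivot elements $v_i=\sum_{k\ge0}\big(\prod_{n=0}^{k-1}x_{i+3n}x_{i+3n+1}\big)\partial_{i+3k}$, $i\ge0$. $\mathbf Q$ is the Lie subsuperalgebra of $(\operatorname{End}\Lambda)^{(-)}$ (supercommutator $[a,b]=ab-(-1)^{|a||b|}ba$) generated by $v_0,v_1,v_2$; in characteristic $2$ it is also closed under squaring of odd elements. *)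

(* Defs.v *)
From HB Require Import structures.
From mathcomp Require Import all_boot all_order all_algebra.
From mathcomp Require Import finmap.
From mathcomp Require Import monalg.

Set Implicit Arguments.
Unset Strict Implicit.
Unset Printing Implicit Defensive.

Import GRing.Theory.
Local Open Scope fset_scope.
Local Open Scope ring_scope.

Section Grassmann.
Variable K : fieldType.

(* The Grassmann algebra over K on odd generators x_0, x_1, ...:
   K-vector space with basis the monomials x_S = x_{i_1} ... x_{i_k}
   (i_1 < ... < i_k), indexed by finite sets S of naturals. *)
Definition Lam := {malg K[{fset nat}]}.

Definition mon (S : {fset nat}) : Lam := << S >>.

Definition sgnb (i : nat) (S : {fset nat}) : K :=
  (-1) ^+ count (fun j => (j < i)%N) (S : seq nat).

Definition lmulB (i : nat) (S : {fset nat}) : Lam :=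
  if i \in S then 0 else sgnb i S *: mon (i |` S).

(* the odd superderivation d_i (d_i(x_j) = delta_ij) on basis monomials *)
Definition derB (i : nat) (S : {fset nat}) : Lam :=
  if i \in S then sgnb i S *: mon (S `\ i) else 0.

Definition linext (B : {fset nat} -> Lam) (f : Lam) : Lam :=
  \sum_(S <- msupp f) f@_S *: B S.

Definition Op := Lam -> Lam.

Definition xop (i : nat) : Op := linext (lmulB i).
Definition dop (i : nat) : Op := linext (derB i).

Definition maxidx (f : Lam) : nat :=
  \max_(S <- msupp f) \max_(j <- (S : seq nat)) j.

Definition xprod (i k : nat) (g : Lam) : Lam :=
  foldr (fun n h => xop (i + 3 * n) (xop (i + 3 * n).+1 h)) g (iota 0 k).

(* pivot element v_i = sum_{k>=0} (prod_{n<k} x_{i+3n} x_{i+3n+1}) d_{i+3k};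
   on a given f only the terms with i+3k <= maxidx f can be nonzero,
   so the infinite sum is the following finite one. *)
Definition pivot (i : nat) : Op :=
  fun f => \sum_(k < (maxidx f).+1) xprod i k (dop (i + 3 * k) f).

Definition parity (S : {fset nat}) : bool := odd #|` S|.

Definition homog (p : bool) (a : Op) : Prop :=
  forall S T, T \in msupp (a (mon S)) -> parity T = parity S (+) p.

Definition proj (p : bool) (f : Lam) : Lam :=
  \sum_(S <- msupp f | parity S == p) f@_S *: mon S.

Definition part (p : bool) (a : Op) : Op :=
  fun f => proj p (a (proj false f)) + proj (~~ p) (a (proj true f)).

Definition opzero : Op := fun _ => 0.
Definition opadd (a b : Op) : Op := fun f => a f + b f.
Definition opscale (c : K) (a : Op) : Op := fun f => c *: a f.

Definition supbr (p q : bool) (a b : Op) : Op :=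
  fun f => a (b f) - (-1) ^+ (p && q) *: b (a f).

Definition opsq (a : Op) : Op := fun f => a (a f).

(* Q = Lie(v_0, v_1, v_2): smallest subspace of End Lambda containing
   v_0, v_1, v_2, closed under supercommutators (extended bilinearly) and
   under squaring of odd elements (the latter is automatic unless char K = 2,
   since a^2 = [a,a]/2 for odd a). *)
Inductive inQ : Op -> Prop :=
  | inQ_gen i : (i < 3)%N -> inQ (pivot i)
  | inQ_zero : inQ opzero
  | inQ_add a b : inQ a -> inQ b -> inQ (opadd a b)
  | inQ_scale c a : inQ a -> inQ (opscale c a)
  | inQ_br p q a b : inQ a -> inQ b -> homog p a -> homog q b ->
      inQ (supbr p q a b)
  | inQ_sq a : inQ a -> homog true a -> inQ (opsq a).

Definition lincomb (n : nat) (c : 'I_n -> K) (b : 'I_n -> Op) : Op :=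
  fun f => \sum_(j < n) c j *: b j f.

Definition Q_infinite_dim : Prop :=
  forall n : nat, exists b : 'I_n -> Op,
    (forall j, inQ (b j)) /\
    (forall c : 'I_n -> K, lincomb c b = opzero -> forall j, c j = 0).

Definition Q_ideal (I : Op -> Prop) : Prop :=
  (forall a, I a -> inQ a) /\
  I opzero /\
  (forall a b, I a -> I b -> I (opadd a b)) /\
  (forall c a, I a -> I (opscale c a)) /\
  (forall p a, I a -> I (part p a)) /\
  (forall p r q a, inQ q -> I a -> homog p q -> homog r a ->
                   I (supbr p r q a)) /\
  (forall a, I a -> homog true a -> I (opsq a)).

Definition finite_codim (I : Op -> Prop) : Prop :=
  exists n (b : 'I_n -> Op), forall q, inQ q ->
    exists (c : 'I_n -> K) (a : Op), I a /\ q = opadd a (lincomb c b).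

End Grassmann.

(* Main.v *)
(** Left multiplication by x_s and the pivots satisfy
      v_m^2 = x_{m+1} v_{m+3},   [v_m, v_{m+1}] = - x_m v_{m+3},
      [v_m, v_n] = x_m x_{m+1} [v_{m+3}, v_n]   (n >= m + 2),
    so Q is spanned by monomials of two kinds: x_s v_m with s below m - 2, and
    x_{m+1} x_s v_{m+3} with s below m - 1, the latter coming from [x_t v_m, x_u v_m]
    with a factor 2, or from v_m^2 when s is empty.  Conversely x_0 ... x_{m-3} v_m
    lies in Q for m >= 8, because bracketing it with v_{m-2} gives
    x_0 ... x_m v_{m+3}; bracketing with v_j removes a factor x_j, so Q contains
    every monomial of the first kind with m >= 8.

    Let a <> 0 be a homogeneous element of an ideal I.  For k large and V a finite
    set that contains a long interval below k - 2, the product x_V [a, v_k] vanishes,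
    hence [a, x_V v_k] = a(x_V) v_k, and V can be chosen with a(x_V) <> 0.  Since
    a(x_V) divides the top monomial of its finite Grassmann algebra, a further
    bracket with a multiple of v_{k+1} and the removal of the factors x_j yield v_{k+3}
    in I.  So I contains all v_n with n large, then all monomials of large index. *)
From HB Require Import structures.
Require Import Defs.
From mathcomp Require Import all_boot all_order all_algebra.
From mathcomp Require Import zify.
From mathcomp Require Import finmap.
From mathcomp Require Import monalg.
From Stdlib Require Import FunctionalExtensionality Classical.

Set Implicit Arguments.
Unset Strict Implicit.
Unset Printing Implicit Defensive.

Import GRing.Theory.
Local Open Scope fset_scope.
Local Open Scope ring_scope.

(** * Anticommutation relations of multiplications and derivations, checked on monomials *)

Section FermionRelations.
Variables (K : fieldType) (L : lmodType K) (mon : {fset nat} -> L).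
Variables X D : nat -> {linear L -> L}.
Implicit Types (f : L) (i j : nat) (S T : {fset nat}).
Hypothesis mon_ext : forall a b : {linear L -> L},
  (forall S, a (mon S) = b (mon S)) -> a =1 b.
Hypothesis XE : forall i S,
  X i (mon S) = if i \in S then 0 else sgnb K i S *: mon (i |` S).
Hypothesis DE : forall i S,
  D i (mon S) = if i \in S then sgnb K i S *: mon (S `\ i) else 0.

Lemma sgnb_sq i S : sgnb K i S * sgnb K i S = 1.
Proof. by rewrite -expr2 sqrr_sign. Qed.

Lemma countU1 (P : pred nat) i S : i \notin S ->
  count P (i |` S : seq nat) = (P i + count P (S : seq nat))%N.
Proof.
move=> iS; have /permP -> // : perm_eq (i |` S : seq nat) (i :: (S : seq nat)).
apply: uniq_perm => [||x] /=; rewrite ?fset_uniq ?andbT //.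
by rewrite in_fset1U inE.
Qed.

Lemma sgnbU1 i j S : j \notin S -> sgnb K i (j |` S) = (-1) ^+ (j < i)%N * sgnb K i S.
Proof. by move=> jS; rewrite /sgnb countU1 // exprD. Qed.

(** Of two distinct indices exactly one precedes the other; this sign is the source of the
    anticommutation relations between distinct indices. *)
Lemma sgn_swap i j : i != j ->
  (-1) ^+ (j < i)%N = - (-1) ^+ (i < j)%N :> K.
Proof. by rewrite neq_ltn => /orP[] h; rewrite h ltnNge (ltnW h) ?expr1 ?expr0 ?opprK. Qed.

Lemma X_anti i j f : X i (X j f) = - X j (X i f).
Proof.
apply: (mon_ext (a := X i \o X j)
                   (b := -%R \o (X j \o X i))) => /= S.
rewrite !XE ; have [<-|ij] := eqVneq i j.
  case: ifP => iS; rewrite ?linear0 ?oppr0 // linearZ /= XE.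
  by rewrite fset1U1 scaler0 oppr0.
case: ifP => jS; case: ifP => iS; rewrite ?linear0 ?oppr0 //.
- by rewrite linearZ /= XE in_fset1U jS orbT scaler0 oppr0.
- by rewrite linearZ /= XE in_fset1U iS orbT scaler0.
rewrite !linearZ /= !XE !in_fset1U [j == i]eq_sym (negbTE ij) iS jS /=.
rewrite !sgnbU1 ?jS ?iS // (sgn_swap ij) fsetUCA ?scalerN !scalerA -scaleNr.
congr (_ *: _); rewrite mulNr mulrN; congr (- _).
by rewrite mulrCA [RHS]mulrCA [sgnb K j S * _]mulrC.
Qed.

Lemma X_sq i f : X i (X i f) = 0.
Proof.
apply: (mon_ext (a := X i \o X i) (b := \0)) => /= S.
rewrite !XE ; case: ifP => iS; rewrite ?linear0 // linearZ /= XE.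
by rewrite fset1U1 scaler0.
Qed.

Lemma D_X i f : D i (X i f) = f - X i (D i f).
Proof.
apply: (mon_ext (a := D i \o X i)
                   (b := idfun \- (X i \o D i))) => /= S.
rewrite XE DE; case: ifP => iS.
  rewrite !linear0 linearZ /= XE !inE eqxx /= fsetD1K // scalerA.
  rewrite -{2}(fsetD1K iS) sgnbU1 ?inE ?eqxx // ltnn mul1r sgnb_sq.
  by rewrite scale1r subrr.
rewrite !linear0 ?subr0 ?addr0 linearZ /= DE fset1U1 scalerA.
rewrite fsetU1K ?iS // sgnbU1 ?iS // ltnn mul1r sgnb_sq scale1r //.
Qed.

Lemma D_X_neq i j f : i != j -> D i (X j f) = - X j (D i f).
Proof.
move=> ij; apply: (mon_ext (a := D i \o X j)
                   (b := -%R \o (X j \o D i))) => /= S.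
rewrite XE DE.
have [iS|iS] := boolP (i \in S); last first.
  case: ifP => jS; rewrite !linear0 ?oppr0 // linearZ /= DE.
  by rewrite in_fset1U (negbTE ij) (negbTE iS) scaler0.
case: ifP => jS.
  rewrite linear0 linearZ /= XE in_fsetD1 eq_sym ij jS.
  by rewrite scaler0 ?oppr0.
rewrite !linearZ /= DE XE in_fset1U iS orbT in_fsetD1 jS andbF.
rewrite ?scalerN !scalerA -scaleNr sgnbU1 ?jS // (sgn_swap ij).
have -> : (j |` S) `\ i = j |` (S `\ i).
  apply/fsetP => x; rewrite !inE.
  by case: (eqVneq x j) => [->|]; rewrite ?andbT ?orbF // eq_sym ij.
congr (_ *: _); rewrite -{1}(fsetD1K iS) sgnbU1 ?inE ?eqxx //.
rewrite mulNr mulrN; congr (- _).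
by rewrite mulrACA -expr2 sqrr_sign mul1r mulrC.
Qed.

Lemma D_anti i j f : i != j -> D i (D j f) = - D j (D i f).
Proof.
move=> ij; apply: (mon_ext (a := D i \o D j)
                   (b := -%R \o (D j \o D i))) => /= S.
rewrite !DE.
have [iS|iS] := boolP (i \in S); have [jS|jS] := boolP (j \in S);
  rewrite ?linear0 ?linearZ /= ?DE ?in_fsetD1
    ?(negbTE iS) ?(negbTE jS) ?andbF ?oppr0 ?scaler0 ?oppr0 //.
rewrite [j == i]eq_sym ij iS jS /= ?scalerN !scalerA -scaleNr.
have -> : S `\ j `\ i = S `\ i `\ j by rewrite fsetDDl fsetUC -fsetDDl.
congr (_ *: _).
have e1 : sgnb K j S = (-1) ^+ (i < j)%N * sgnb K j (S `\ i).
  by rewrite -{1}(fsetD1K iS) sgnbU1 ?inE ?eqxx.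
have e2 : sgnb K i S = (-1) ^+ (j < i)%N * sgnb K i (S `\ j).
  by rewrite -{1}(fsetD1K jS) sgnbU1 ?inE ?eqxx.
rewrite e1 e2 (sgn_swap ij) !mulNr opprK -!mulrA; congr (_ * _).
exact: mulrC.
Qed.

Lemma D_sq i f : D i (D i f) = 0.
Proof.
apply: (mon_ext (a := D i \o D i) (b := \0)) => /= S.
rewrite !DE ; case: ifP => iS; rewrite ?linear0 // linearZ /= DE.
by rewrite !inE eqxx scaler0.
Qed.

End FermionRelations.

(** * Linear spans of families of operators *)

Section Span.
Variables (K : fieldType) (L : lmodType K).
Notation op := (L -> L).
Implicit Types (G : op -> Prop) (a b u w : op).

(** Built one scaled generator at a time, so that induction peels off a single generator and linear
    operations on operators are tested on generators only. *)
Inductive span G : op -> Prop :=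
  | span0 : span G (fun=> 0)
  | spanS c a b : G a -> span G b -> span G (fun f => c *: a f + b f).

Lemma span_eq G a b : a =1 b -> span G a -> span G b.
Proof. by move=> /functional_extensionality ->. Qed.

Lemma spanZ G c a : span G a -> span G (fun f => c *: a f).
Proof.
elim=> [|c' a' b Ga _ IH]; first by apply: span_eq (span0 G) => f; rewrite scaler0.
by apply: span_eq (spanS (c * c') Ga IH) => f; rewrite scalerDr scalerA.
Qed.

Lemma spanD G a b : span G a -> span G b -> span G (fun f => a f + b f).
Proof.
move=> + Gb; elim=> [|c a' b' Ga _ IH].
  by apply: span_eq Gb => f; rewrite add0r.
by apply: span_eq (spanS c Ga IH) => f; rewrite addrA.
Qed.

Lemma spanN G a : span G a -> span G (fun f => - a f).
Proof. by move=> /(spanZ (-1)); apply: span_eq => f; rewrite scaleN1r. Qed.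

Lemma span_gen G a : G a -> span G a.
Proof. by move=> Ga; apply: span_eq (spanS 1 Ga (span0 G)) => f; rewrite scale1r addr0. Qed.

Lemma span_linear G a : (forall b, G b -> linear b) -> span G a -> linear a.
Proof.
move=> lG; elim=> [|c b b' /lG lb _ lb'] d f g; first by rewrite scaler0 addr0.
rewrite lb lb' !scalerDr !scalerA addrACA; congr (_ + _ + _).
by rewrite mulrC.
Qed.

Lemma span_sub G G' a : (forall b, G b -> span G' b) -> span G a -> span G' a.
Proof.
move=> GG'; elim=> [|c b b' /GG' Gb _ IH]; first exact: span0.
exact: spanD (spanZ c Gb) IH.
Qed.

Lemma span_map G G' (F : op -> op) a : F (fun=> 0) =1 (fun=> 0) ->
  (forall c b b', F (fun f => c *: b f + b' f) =1 fun f => c *: F b f + F b' f) ->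
  (forall b, G b -> span G' (F b)) -> span G a -> span G' (F a).
Proof.
move=> F0 FS GG'; elim=> [|c b b' /GG' Gb _ IH].
  by apply: span_eq (span0 _) => f; rewrite F0.
by apply: span_eq (spanD (spanZ c Gb) IH) => f; rewrite FS.
Qed.

Lemma linear_fun0 a : linear a -> a 0 = 0.
Proof. by move=> la; have := la (-1) 0 0; rewrite scaleN1r oppr0 add0r scaleN1r addNr. Qed.

Lemma span_comp G G' u w a : linear u ->
  (forall b, G b -> span G' (fun f => u (b (w f)))) ->
  span G a -> span G' (fun f => u (a (w f))).
Proof.
move=> lu; apply: (span_map (F := fun a f => u (a (w f)))) => [f|c b b' f].
  exact: linear_fun0.
exact: lu.
Qed.

End Span.

(** * Supercommutators of pivots and generators, from abstract relations *)

Section PivotAlgebra.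
Variables (K : fieldType) (L : lmodType K).
Notation op := (L -> L).
Variables X D V : nat -> {linear L -> L}.
Implicit Types (f h : L) (g : op) (i j k m n : nat) (s t l : seq nat) (a b : op).
Hypothesis X_anti : forall i j f, X i (X j f) = - X j (X i f).
Hypothesis X_sq : forall i f, X i (X i f) = 0.
Hypothesis D_X : forall i f, D i (X i f) = f - X i (D i f).
Hypothesis D_X_neq : forall i j f, i != j -> D i (X j f) = - X j (D i f).
Hypothesis D_sq : forall i f, D i (D i f) = 0.
Hypothesis V_rec : forall m f, V m f = D m f + X m (X m.+1 (V m.+3 f)).
Hypothesis V_X_lt : forall m j f, (j < m)%N -> V m (X j f) = - X j (V m f).
Hypothesis V_D_lt : forall m j f, (j < m)%N -> V m (D j f) = - D j (V m f).

Fixpoint xs s f : L := if s is i :: s' then X i (xs s' f) else f.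

Lemma xs_is_linear s : linear (xs s).
Proof. by elim: s => //= i s IH c f g; rewrite IH linearP. Qed.
HB.instance Definition _ s := GRing.isLinear.Build K L L _ (xs s) (xs_is_linear s).

Lemma xsZ s c f : xs s (c *: f) = c *: xs s f.
Proof. exact: linearZ. Qed.

Lemma xs_cat s t f : xs (s ++ t) f = xs s (xs t f).
Proof. by elim: s => //= i s ->. Qed.

Lemma sgnS n : (-1) ^+ n.+1 = - (-1) ^+ n :> K.
Proof. by rewrite exprS mulN1r. Qed.

Lemma xs_X j s f : xs s (X j f) = (-1) ^+ size s *: X j (xs s f).
Proof.
elim: s => [|i s IH] /=; first by rewrite scale1r.
by rewrite IH linearZ /= X_anti scalerN -scaleNr sgnS.
Qed.

Lemma xs_xs s t f : xs s (xs t f) = (-1) ^+ (size s * size t) *: xs t (xs s f).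
Proof.
elim: t f => [|j t IH] f /=; first by rewrite muln0 scale1r.
by rewrite xs_X IH linearZ /= scalerA -exprD mulnS.
Qed.

Lemma V_xs m s f : all (gtn m) s ->
  V m (xs s f) = (-1) ^+ size s *: xs s (V m f).
Proof.
elim: s => [|i s IH] /=; first by rewrite scale1r.
by case/andP=> im sm; rewrite V_X_lt // IH // linearZ /= sgnS scaleNr.
Qed.

Lemma xs_mem0 j s f : j \in s -> X j (xs s f) = 0.
Proof.
elim: s => //= i s IH; rewrite inE => /orP[/eqP->|js]; first by rewrite X_sq.
by rewrite X_anti IH // linear0 oppr0.
Qed.

Lemma X_xs0 j s f : X j f = 0 -> X j (xs s f) = 0.
Proof.
move=> f0; have := xs_X j s f; rewrite f0 linear0 => /esym/eqP.
by rewrite scaler_eq0 signr_eq0 => /eqP.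
Qed.

Lemma xs_mem0r j s f : j \in s -> xs s (X j f) = 0.
Proof. by move=> js; rewrite xs_X xs_mem0 // scaler0. Qed.

Lemma xs_nuniq s f : ~~ uniq s -> xs s f = 0.
Proof.
elim: s => //= i s IH; rewrite negb_and negbK => /orP[si|/IH ->].
  exact: xs_mem0.
by rewrite linear0.
Qed.

Lemma xs_perm s t : perm_eq s t -> exists e : nat, forall f, xs s f = (-1) ^+ e *: xs t f.
Proof.
elim: s t => [|i s IH] t.
  by move=> /perm_size /esym /size0nil ->; exists 0%N => f; rewrite scale1r.
move=> pst; have it : i \in t by rewrite -(perm_mem pst) mem_head.
case/splitPr: it pst => p1 p2 pst.
have {}pst : perm_eq s (p1 ++ p2).
  by rewrite -(perm_cons i) (perm_trans pst) //; apply/permEl/(perm_catCA p1 [:: i] p2).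
have [e He] := IH _ pst; exists (e + size p1)%N => f /=.
rewrite He linearZ /= !xs_cat /= xs_X scalerA exprD -mulrA -expr2.
by rewrite sqrr_sign mulr1.
Qed.

Definition mo s m : op := fun f => xs s (V m f).

Lemma mo_is_linear s m : linear (mo s m).
Proof. by move=> c f g; rewrite /mo !linearP. Qed.

(* The supercommutators [v_m, v_n], [v_m, x_j] and [v_m, x_t]. *)
Definition ac m n f := V m (V n f) + V n (V m f).
Definition dx m j f := V m (X j f) + X j (V m f).
Definition cm m t f := V m (xs t f) - (-1) ^+ size t *: xs t (V m f).

Lemma acC m n f : ac m n f = ac n m f.
Proof. exact: addrC. Qed.

Lemma XX_X i j k f : X i (X j (X k f)) = X k (X i (X j f)).
Proof. by rewrite (X_anti j k) linearN (X_anti i k) opprK. Qed.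

Lemma V_XX m i j f : (i < m)%N -> (j < m)%N -> V m (X i (X j f)) = X i (X j (V m f)).
Proof. by move=> im jm; rewrite !V_X_lt // linearN opprK. Qed.

Lemma dx_lt m j f : (j < m)%N -> dx m j f = 0.
Proof. by move=> jm; rewrite /dx V_X_lt // addNr. Qed.

Lemma dx_id m f : dx m m f = f.
Proof.
rewrite /dx (V_rec m (X m f)) (V_rec m f) D_X V_X_lt; last by lia.
rewrite !linearN linearD /= X_sq addr0 XX_X X_sq oppr0 addr0.
by rewrite subrK.
Qed.

Lemma dx_gt m j f : (m < j)%N -> dx m j f = X m (X m.+1 (dx m.+3 j f)).
Proof.
move=> mj; rewrite /dx (V_rec m (X j f)) (V_rec m f) D_X_neq; last by lia.
by rewrite !linearD /= addrACA addNr add0r (XX_X m m.+1 j).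
Qed.

(** Iterating [dx_gt] raises m by 3 and collects two letters each time, until m equals j (value 1)
    or passes it (value 0). *)
Lemma dx_cases m j : (forall f, dx m j f = 0) \/
  exists l, [/\ all (gtn j) l, ~~ odd (size l) & forall f, dx m j f = xs l f].
Proof.
have [n] := ubnP (j - m)%N; elim: n m => // n IH m le_n.
have [jm|mj|<-] := ltngtP j m; first by left=> f; apply: dx_lt.
  have [|d0|[l [lj el dl]]] := IH m.+3; first by lia.
    by left=> f; rewrite dx_gt // d0 !linear0.
  have [j3|j3] := ltnP j m.+3.
    by left=> f; rewrite dx_gt // dx_lt // !linear0.
  right; exists [:: m, m.+1 & l]; split=> [||f] /=; rewrite ?negbK ?lj //.
    by apply/and3P; split=> //; lia.
  by rewrite dx_gt // dl.
by right; exists [::]; split=> // f; apply: dx_id.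
Qed.

Lemma X_dx j i f : i != j -> X j (dx j i f) = 0.
Proof.
by rewrite neq_ltn => /orP[ij|ji]; [rewrite dx_lt // linear0 | rewrite dx_gt // X_sq].
Qed.

Lemma cm_cons m j t f : cm m (j :: t) f = dx m j (xs t f) - X j (cm m t f).
Proof.
rewrite /cm /dx /= sgnS scaleNr opprK linearB linearZ /= opprB.
by rewrite [X in _ = _ + X]addrC addrA addrK.
Qed.

Lemma cm_nil m f : cm m [::] f = 0.
Proof. by rewrite /cm /= scale1r subrr. Qed.

Lemma cm_lt m t f : all (gtn m) t -> cm m t f = 0.
Proof. by move=> tm; rewrite /cm V_xs // subrr. Qed.

(** By the Leibniz rule every term of [v_j, x_t] contains some [v_j, x_i] with i distinct from j,
    which is zero or starts with x_j. *)
Lemma X_cm j t f : j \notin t -> X j (cm j t f) = 0.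
Proof.
elim: t f => [|i t IH] f; first by rewrite cm_nil linear0.
rewrite inE negb_or => /andP[ji jt]; rewrite cm_cons linearB /= X_dx 1?eq_sym //.
by rewrite X_anti IH // linear0 oppr0 subr0.
Qed.

(** Its span is the parity p part of the Grassmann algebra on x_0, ..., x_{B-1}, acting by
    multiplication. *)
Definition coef B p (a : op) := exists l, [/\ all (gtn B) l, odd (size l) = p & a = xs l].

Lemma coef_X j B p a : (j < B)%N -> span (coef B p) a ->
  span (coef B (~~ p)) (fun f => X j (a f)).
Proof.
move=> jB; apply: (span_comp (w := id)) => [c f g|_ [l [lB <- ->]]].
  exact: linearP.
by apply: span_gen; exists (j :: l); rewrite /= jB.
Qed.

(** Each Leibniz term replaces one letter j of t by zero or by an even product of letters below j,
    so the bound B survives and the parity flips. *)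
Lemma cm_span m B t : all (gtn B) t -> span (coef B (~~ odd (size t))) (cm m t).
Proof.
elim: t => [|j t IH] /=.
  by move=> _; apply: span_eq (span0 _) => f; rewrite cm_nil.
case/andP=> jB tB; apply: (span_eq (fun f => esym (cm_cons m j t f))).
apply: spanD; last exact: spanN (coef_X _ (IH _)).
have [d0|[l [lj el dl]]] := dx_cases m j.
  by apply: span_eq (span0 _) => f; rewrite d0.
apply: span_gen; exists (l ++ t); split.
- by rewrite all_cat tB andbT; apply: sub_all lj => x /= /ltn_trans; apply.
- by rewrite size_cat oddD (negbTE el) negbK.
by apply: functional_extensionality => f; rewrite dl xs_cat.
Qed.

(** Write v_m = d_m + x_m x_{m+1} v_{m+3}. Both summands square to zero, and their anticommutator is
    x_{m+1} v_{m+3}. No division by 2 occurs. *)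
Lemma V_sq m f : V m (V m f) = X m.+1 (V m.+3 f).
Proof.
have e1 : D m (V m f) = X m.+1 (V m.+3 f) + X m (X m.+1 (D m (V m.+3 f))).
  rewrite (V_rec m) linearD /= D_sq add0r D_X D_X_neq; last by lia.
  by rewrite linearN opprK.
have e2 : V m.+3 (V m f) = - D m (V m.+3 f) + X m (X m.+1 (V m.+3 (V m.+3 f))).
  by rewrite (V_rec m f) linearD /= V_D_lt ?V_XX //; lia.
rewrite (V_rec m (V m f)) e1 e2 !linearD !linearN /= (XX_X m m.+1 m) X_sq addr0.
by rewrite addrK.
Qed.

Lemma ac_id m f : ac m m f = 2%:R *: X m.+1 (V m.+3 f).
Proof. by rewrite /ac V_sq scaler_nat mulr2n. Qed.

(** For n above m + 1, v_n anticommutes with d_m and commutes with x_m x_{m+1}. *)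
Lemma ac_far m n f : (m.+1 < n)%N -> ac m n f = X m (X m.+1 (ac m.+3 n f)).
Proof.
move=> mn; rewrite /ac [V m (V n f)]V_rec [V m f]V_rec !linearD /=.
by rewrite V_D_lt ?V_XX //; try lia; rewrite addrACA subrr add0r.
Qed.

Lemma X_ac m n f : (m.+1 < n)%N -> X m (ac m n f) = 0.
Proof. by move=> mn; rewrite ac_far // X_sq. Qed.

(** Moving v_{m+1} past x_{m+1} leaves - x_m v_{m+3}; the remaining x_m x_{m+1} [v_{m+3}, v_{m+1}]
    is killed by x_{m+1}. *)
Lemma ac_next m f : ac m m.+1 f = - X m (V m.+3 f).
Proof.
have e : V m.+1 (X m.+1 (V m.+3 f)) = V m.+3 f - X m.+1 (V m.+1 (V m.+3 f)).
  by apply/eqP; rewrite -subr_eq opprK; apply/eqP; apply: (dx_id m.+1).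
rewrite /ac [V m (V _ f)]V_rec [V m f]V_rec linearD /= V_D_lt // V_X_lt // e.
rewrite addrACA subrr add0r linearB /= opprB addrA -!linearD /=.
by rewrite -/(ac m.+3 m.+1 f) acC X_ac // linear0 add0r.
Qed.

(** Steps of 3 by [ac_far] reduce n - m to 1, 2 or 0, which gives the three cases in this order. *)
Lemma ac_cases m n : (m <= n)%N -> exists l,
  [\/ [/\ odd (size l), all (gtn n) l & forall f, ac m n f = - mo l n.+2 f],
      [/\ odd (size l), all (gtn n.+1) l & forall f, ac m n f = - mo l n.+3 f] |
      [/\ ~~ odd (size l), all (fun j => j.+1 < n)%N l &
         forall f, ac m n f = 2%:R *: mo (n.+1 :: l) n.+3 f]].
Proof.
have [k] := ubnP (n - m)%N; elim: k m => // k IH m le_k.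
rewrite leq_eqVlt => /orP[/eqP mn|]; first subst m.
  by exists [::]; constructor 3; split=> // f; rewrite ac_id.
rewrite leq_eqVlt => /orP[/eqP mn|mn]; first subst n.
  by exists [:: m]; constructor 1; split=> [//||f]; rewrite /= ?ltnSn // ac_next.
have [<-|mn3] := eqVneq m.+2 n.
  exists [:: m; m.+1; m.+2]; constructor 2; split=> // [|f] /=; first by lia.
  by rewrite ac_far // acC ac_next !linearN.
have [||l [[ol ln e]|[ol ln e]|[ol ln e]]] := IH m.+3; try lia.
- exists [:: m, m.+1 & l]; constructor 1; split=> [||f] /=; rewrite ?negbK ?ln //.
    by lia.
  by rewrite ac_far // e !linearN.
- exists [:: m, m.+1 & l]; constructor 2; split=> [||f] /=; rewrite ?negbK ?ln //.
    by lia.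
  by rewrite ac_far // e !linearN.
exists [:: m, m.+1 & l]; constructor 3; split=> [||f] /=; rewrite ?negbK ?ln //.
  by lia.
by rewrite ac_far // e !linearZ /mo /= XX_X.
Qed.

(** * The span of the two kinds of monomials is closed under brackets and squares *)

Definition supB p q a b : op := fun f => a (b f) - (-1) ^+ (p && q) *: b (a f).

Lemma supBC p q a b f : supB p q a b f = - (-1) ^+ (p && q) *: supB q p b a f.
Proof.
rewrite /supB [q && p]andbC scalerBr !scalerA mulNr -expr2 sqrr_sign scaleN1r opprK.
by rewrite addrC scaleNr.
Qed.

Lemma supBZr p q c a b f : linear a ->
  supB p q a (fun h => c *: b h) f = c *: supB p q a b f.
Proof.
move=> la; have -> : supB p q a (fun h => c *: b h) f =
    c *: a (b f) - (-1) ^+ (p && q) *: (c *: b (a f)).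
  by rewrite /supB -[c *: b f]addr0 la (linear_fun0 la) addr0.
by rewrite scalerBr !scalerA mulrC.
Qed.

Lemma br_sign x y :
  (-1) ^+ (~~ odd x && ~~ odd y) * ((-1) ^+ x * (-1) ^+ (y * x)) = - (-1) ^+ y :> K.
Proof.
rewrite -(signr_odd _ x) -(signr_odd _ y) -(signr_odd _ (y * x)) oddM.
by case: (odd x); case: (odd y); rewrite /= ?(expr0, expr1, mulr1, mul1r, mulN1r, opprK).
Qed.

(** Since v_n supercommutes with x_s, the Leibniz rule leaves only the terms with [v_m, x_t] and
    [v_m, v_n]. *)
Lemma br_mo m n s t f : all (gtn n) s ->
  supB (~~ odd (size s)) (~~ odd (size t)) (mo s m) (mo t n) f =
  xs s (cm m t (V n f)) + (-1) ^+ size t *: xs s (xs t (ac m n f)).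
Proof.
move=> sn; rewrite /supB /mo (V_xs _ sn) xsZ (xs_xs t s) !scalerA.
rewrite -mulrA br_sign scaleNr opprK /cm /ac linearB /= xsZ !linearD /= ?scalerDr.
by rewrite addrA subrK.
Qed.

(* In characteristic 2, x_{m+1} x_s v_{m+3} is not in Q unless s is empty, hence the
   factor 2 in gen2. *)
Inductive gen : bool -> nat -> op -> Prop :=
  | gen1 s m : all (fun j => j.+2 < m)%N s -> gen (~~ odd (size s)) m (mo s m)
  | gen2 s m : all (fun j => j.+1 < m)%N s ->
      gen (odd (size s)) m.+3 (fun f => 2%:R *: mo (m.+1 :: s) m.+3 f)
  | gen3 m : gen false m.+3 (mo [:: m.+1] m.+3).

Definition W p := span (fun g => exists n, gen p n g).

Lemma gen_mo p n g : gen p n g ->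
  exists c s, [/\ all (fun j => j.+1 < n)%N s, p = ~~ odd (size s) &
                  g = fun f => c *: mo s n f].
Proof.
case=> [s m sm|s m sm|m].
- exists 1, s; split=> //; first by apply: sub_all sm => x /= /ltnW.
  by apply: functional_extensionality => f; rewrite scale1r.
- exists 2%:R, (m.+1 :: s); split=> //=; last by rewrite negbK.
  by rewrite ltnSn; apply: sub_all sm => x /= ?; lia.
exists 1, [:: m.+1]; split=> //=; first by rewrite ltnSn.
by apply: functional_extensionality => f; rewrite scale1r.
Qed.

Lemma gen_linear p n g : gen p n g -> linear g.
Proof.
case/gen_mo=> c [s [_ _ ->]] d f h.
by rewrite mo_is_linear scalerDr !scalerA mulrC.
Qed.

Lemma W_linear p a : W p a -> linear a.
Proof. by apply: span_linear => b [n /gen_linear]. Qed.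

Lemma W_gen1 p s m : all (fun j => j.+2 < m)%N s -> p = ~~ odd (size s) -> W p (mo s m).
Proof. by move=> sm ->; apply: span_gen; exists m; apply: gen1. Qed.

Lemma W_gen2 p s m : all (fun j => j.+1 < m)%N s -> p = odd (size s) ->
  W p (fun f => 2%:R *: mo (m.+1 :: s) m.+3 f).
Proof. by move=> sm ->; apply: span_gen; exists m.+3; apply: gen2. Qed.

Lemma W_ac m n s : (m <= n)%N -> all (fun j => j.+1 < n)%N s ->
  W (odd (size s)) (fun f => xs s (ac m n f)).
Proof.
move=> /ac_cases[l [[ol ln e]|[ol ln e]|[ol ln e]]] sn.
- apply: span_eq (spanN (W_gen1 (s := s ++ l) (m := n.+2) _ _)) => [f||].
  + by rewrite e linearN /mo xs_cat.
  + rewrite all_cat; apply/andP; split; last exact: sub_all ln.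
    by apply: sub_all sn => x /= ?; lia.
  by rewrite size_cat oddD ol addbT negbK.
- apply: span_eq (spanN (W_gen1 (s := s ++ l) (m := n.+3) _ _)) => [f||].
  + by rewrite e linearN /mo xs_cat.
  + rewrite all_cat; apply/andP; split; last exact: sub_all ln.
    by apply: sub_all sn => x /= ?; lia.
  by rewrite size_cat oddD ol addbT negbK.
apply: span_eq (spanZ ((-1) ^+ size s) (W_gen2 (s := s ++ l) (m := n) _ _)) => [f||].
- by rewrite e xsZ /mo /= xs_X xs_cat !scalerA mulrC.
- by rewrite all_cat sn.
by rewrite size_cat oddD (negbTE ol) addbF.
Qed.

Lemma W_cm m n s t : (m <= n)%N -> all (fun j => j.+1 < m)%N s ->
  all (fun j => j.+2 < n)%N t ->
  W (odd (size s) (+) odd (size t)) (fun f => xs s (cm m t (V n f))).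
Proof.
move=> mn sm tn; have [nm|mn2] := leqP n m.+2.
  apply: span_eq (span0 _) => f; rewrite cm_lt ?linear0 //.
  by apply: sub_all tn => x /= ?; lia.
have tB : all (gtn (n - 2)%N) t by apply: sub_all tn => x /= ?; lia.
apply: (span_comp _ _ (cm_span m tB)) => [|_ [l [lB ol ->]]].
  exact: xs_is_linear.
apply: span_eq (W_gen1 (s := s ++ l) (m := n) _ _) => [f||].
- by rewrite /mo xs_cat.
- rewrite all_cat; apply/andP; split; first by apply: sub_all sm => x /= ?; lia.
  by apply: sub_all lB => x /= ?; lia.
by rewrite size_cat oddD ol; case: odd; case: odd.
Qed.

Lemma W_dx m n s t : all (fun j => j.+1 < m)%N s -> all (fun j => j.+1 < n)%N t ->
  W (~~ odd (size s) (+) odd (size t)) (fun f => xs s (dx m n.+1 (xs t (V n.+3 f)))).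
Proof.
move=> sm tn; have [nm|mn] := ltnP n.+1 m.
  by apply: span_eq (span0 _) => f; rewrite dx_lt // linear0.
have [d0|[l [ln el dl]]] := dx_cases m n.+1.
  by apply: span_eq (span0 _) => f; rewrite d0 linear0.
apply: span_eq (W_gen1 (s := s ++ l ++ t) (m := n.+3) _ _) => [f||].
- by rewrite /mo !xs_cat dl.
- rewrite !all_cat; apply/and3P; split; first by apply: sub_all sm => x /= ?; lia.
    by apply: sub_all ln => x /= ?; lia.
  by apply: sub_all tn => x /= ?; lia.
by rewrite !size_cat !oddD (negbTE el) /=; case: odd; case: odd.
Qed.

Lemma W_X_cm m n s t : all (fun j => j.+1 < m)%N s -> all (fun j => j.+1 < n)%N t ->
  W (~~ odd (size s) (+) odd (size t))
    (fun f => 2%:R *: xs s (X n.+1 (cm m t (V n.+3 f)))).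
Proof.
move=> sm tn; have [nm|mn2] := leqP n m.+1.
  apply: span_eq (span0 _) => f; rewrite cm_lt ?linear0 ?scaler0 //.
  by apply: sub_all tn => x /= ?; lia.
have tB : all (gtn (n - 1)%N) t by apply: sub_all tn => x /= ?; lia.
apply: (span_comp (u := fun f => 2%:R *: xs s (X n.+1 f)) _ _ (cm_span m tB))
  => [c f g|_ [l [lB ol ->]]].
  by rewrite !linearP.
apply: span_eq (spanZ ((-1) ^+ size s) (W_gen2 (s := s ++ l) (m := n) _ _)) => [f||].
- by rewrite /mo /= xs_X xs_cat !scalerA mulrC.
- rewrite all_cat; apply/andP; split; first by apply: sub_all sm => x /= ?; lia.
  by apply: sub_all lB => x /= ?; lia.
by rewrite size_cat oddD ol; case: odd; case: odd.
Qed.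

Lemma W_br_mo_gen m n s q g : (m <= n)%N -> all (fun j => j.+1 < m)%N s -> gen q n g ->
  W (~~ odd (size s) (+) q) (supB (~~ odd (size s)) q (mo s m) g).
Proof.
move=> mn sm gg.
have sn1 : all (fun j => j.+1 < n)%N s by apply: sub_all sm => x /= ?; lia.
have sn : all (gtn n) s by apply: sub_all sn1 => x /= ?; lia.
have Wac t : all (fun j => j.+1 < n)%N t -> W (~~ odd (size s) (+) ~~ odd (size t))
    (fun f => (-1) ^+ size t *: xs s (xs t (ac m n f))).
  move=> tn; rewrite addNb addbN negbK -oddD -size_cat.
  apply: span_eq (spanZ ((-1) ^+ size t) (W_ac mn (s := s ++ t) _)) => [f|].
    by rewrite xs_cat.
  by rewrite all_cat sn1.
have key t : all (fun j => j.+1 < n)%N t ->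
    W (odd (size s) (+) odd (size t)) (fun f => xs s (cm m t (V n f))) ->
    W (~~ odd (size s) (+) ~~ odd (size t))
      (supB (~~ odd (size s)) (~~ odd (size t)) (mo s m) (mo t n)).
  move=> tn Wt; apply: span_eq (fun f => esym (br_mo _ _ _ sn)) _.
  by apply: spanD (Wac _ tn); rewrite addNb addbN negbK.
case: gg mn sn1 sn Wac key => {n q g} [t n tn|t n tn|n] mn sn1 sn Wac key.
- by apply: key (W_cm mn sm tn); apply: sub_all tn => x /= ?; lia.
- have tn3 : all (fun j => j.+1 < n.+3)%N (n.+1 :: t).
    by rewrite /= ltnSn; apply: sub_all tn => x /= ?; lia.
  (* The letter x_{n+1} is peeled off x_{n+1} x_t: when v_m hits it, a monomial of the first kind
     results; when v_m hits x_t, x_{n+1} survives and the factor 2 must be kept. *)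
  have := Wac _ tn3; rewrite /= negbK => /(spanZ 2%:R) W1.
  have W2 := spanZ 2%:R (W_dx sm tn).
  have W3 := spanN (W_X_cm sm tn).
  apply: span_eq (spanD (spanD W2 W3) W1) => f.
  rewrite -scalerBr -linearB /= -cm_cons -scalerDr -(br_mo _ (n.+1 :: t) _ sn) /=.
  by rewrite negbK (supBZr _ _ _ _ _ (mo_is_linear s m)).
apply: (key [:: n.+1]); first by rewrite /= ltnSn.
have /= := W_dx (n := n) (t := [::]) sm isT; rewrite addNb -addbN.
by apply: span_eq => f; rewrite cm_cons cm_nil linear0 subr0.
Qed.

Lemma W_br_gen p q m n a b : gen p m a -> gen q n b -> W (p (+) q) (supB p q a b).
Proof.
wlog mn : p q m n a b / (m <= n)%N => [hw ga gb|ga gb].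
  have [mn|/ltnW nm] := leqP m n; first exact: hw mn ga gb.
  rewrite addbC; apply: (span_eq (fun f => esym (supBC p q a b f))).
  exact/spanZ/(hw _ _ _ _ _ _ nm gb ga).
have lb := gen_linear gb; have [c [s [sm -> ->]]] := gen_mo ga.
apply: span_eq (spanZ c (W_br_mo_gen mn sm gb)) => f.
rewrite /supB scalerBr; congr (_ - _).
by rewrite -[c *: mo s m f]addr0 lb (linear_fun0 lb) addr0 !scalerA mulrC.
Qed.

Lemma W_br p q a b : W p a -> W q b -> W (p (+) q) (supB p q a b).
Proof.
move=> Wa Wb; have lb := W_linear Wb.
apply: (span_map (F := fun a => supB p q a b)) Wa => [f|c a1 a2 f|{}a [m ga]].
- by rewrite /supB (linear_fun0 lb) scaler0 subr0.
- rewrite /supB lb scalerDr opprD addrACA scalerBr; congr (_ - _ + _).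
  by rewrite !scalerA mulrC.
have la := gen_linear ga.
apply: (span_map (F := fun b => supB p q a b)) Wb => [f|c b1 b2 f|{lb}b [n gb]].
- by rewrite /supB (linear_fun0 la) scaler0 subr0.
- rewrite /supB la scalerDr opprD addrACA scalerBr; congr (_ - _ + _).
  by rewrite !scalerA mulrC.
exact: W_br_gen ga gb.
Qed.

Lemma mo_sq0 s m f : all (gtn m) s -> s != [::] -> mo s m (mo s m f) = 0.
Proof.
move=> sm s0; rewrite /mo V_xs // linearZ /= -xs_cat xs_nuniq ?scaler0 //.
case: s s0 {sm} => //= i s _.
by rewrite mem_cat mem_head orbT.
Qed.

(** Squaring repeats every letter of the monomial, so only a bare pivot has a nonzero square. *)
Lemma W_sq_gen n a : gen true n a -> W false (fun f => a (a f)).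
Proof.
move En : true => p ga; case: ga En => {p n a} [s m sm _|s m sm _|//].
  case: s sm => [|i s] sm.
    apply: span_eq (span_gen _) => [f|]; last by exists m.+3; apply: gen3.
    by rewrite /mo /= V_sq.
  apply: span_eq (span0 _) => f; rewrite mo_sq0 //.
  by apply: sub_all sm => x /= ?; lia.
apply: span_eq (span0 _) => f.
have l := mo_is_linear (m.+1 :: s) m.+3.
rewrite -[2%:R *: mo _ _ f]addr0 l (linear_fun0 l) addr0 mo_sq0 ?scaler0 //=.
by apply/andP; split; [lia | apply: sub_all sm => x /= ?; lia].
Qed.

(** Polarization (c g + b)^2 = c^2 g^2 + c [g, b] + b^2 reduces to generators in every
    characteristic. *)
Lemma W_sq a : W true a -> W false (fun f => a (a f)).
Proof.
elim=> [|c g b [n gg] Wb IH]; first exact: span0.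
have lg := gen_linear gg; have lb := W_linear Wb.
have W1 := W_br (span_gen (ex_intro _ n gg)) Wb.
have W2 := W_sq_gen gg.
apply: span_eq (spanD (spanD (spanZ (c * c) W2) (spanZ c W1)) IH) => f.
rewrite /supB lg lb expr1 scaleN1r opprK !scalerDr !scalerA !addrA; congr (_ + _).
Qed.

(** * The parity grading *)

Variables (one : L) (gr : bool -> L -> Prop).
Hypothesis gr0 : forall p, gr p 0.
Hypothesis grD : forall p f h, gr p f -> gr p h -> gr p (f + h).
Hypothesis grZ : forall p c f, gr p f -> gr p (c *: f).
Hypothesis gr_disj : forall p f, gr p f -> gr (~~ p) f -> f = 0.
Hypothesis gr_X : forall p i f, gr p f -> gr (~~ p) (X i f).
Hypothesis gr_V : forall p m f, gr p f -> gr (~~ p) (V m f).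
Hypothesis gr_one : gr false one.
Hypothesis V_one : forall m, V m one = 0.
Hypothesis xs_one : forall s, uniq s -> xs s one <> 0.
Hypothesis op_ext : forall a : op, linear a ->
  (forall s, a (xs s one) = 0) -> forall f, a f = 0.

Definition hom p (a : op) := forall q f, gr q f -> gr (q (+) p) (a f).

Lemma gr_xs q s f : gr q f -> gr (q (+) odd (size s)) (xs s f).
Proof.
move=> qf; elim: s => [|i s IH] /=; first by rewrite addbF.
by rewrite addbN; apply: gr_X.
Qed.

Lemma hom_mo s m : hom (~~ odd (size s)) (mo s m).
Proof. by move=> q f qf; rewrite addbN -addNb; apply/gr_xs/gr_V. Qed.

Lemma hom_span (G : op -> Prop) p a : (forall b, G b -> hom p b) -> span G a -> hom p a.
Proof.
move=> Gh; elim=> [|c b b' /Gh hb _ hb'] q f qf; first exact: gr0.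
by apply: grD; [apply/grZ/hb | apply: hb'].
Qed.

Lemma W_hom p a : W p a -> hom p a.
Proof.
apply: hom_span => b [n /gen_mo[c [s [_ -> ->]]]] q f qf.
exact/grZ/hom_mo.
Qed.

(** As (a + b) - a, the operator b has parity p besides its own parity, so it kills every
    monomial. *)
Lemma W_hom0 p a b : W p a -> W (~~ p) b -> hom p (fun f => a f + b f) ->
  forall f, b f = 0.
Proof.
move=> Wa Wb hab; apply: op_ext (W_linear Wb) _ => s.
have gs : gr (odd (size s)) (xs s one) by have := gr_xs s gr_one.
apply: (@gr_disj (odd (size s) (+) p)); last by rewrite -addbN; apply: (W_hom Wb).
have -> : b (xs s one) = (a (xs s one) + b (xs s one)) + (-1) *: a (xs s one).
  by rewrite scaleN1r addrC addKr.
by apply: grD; [apply: hab | apply/grZ/(W_hom Wa)].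
Qed.

(** * Extracting monomials by brackets inside Q and its ideals *)

Variable Q : op -> Prop.

(** Shared by Q itself and by its ideals, so that the extraction lemmas below apply to both. *)
Definition absorbing (P : op -> Prop) :=
  [/\ P (fun=> 0), forall c a, P a -> P (fun f => c *: a f) &
      forall p r q a, Q q -> P a -> hom p q -> hom r a -> P (supB p r q a)].

Hypothesis Q_abs : absorbing Q.
Hypothesis Q_gen : forall m, (m < 3)%N -> Q (mo [::] m).
Hypothesis Q_sq : forall a, Q a -> hom true a -> Q (fun f => a (a f)).

Section Absorbing.
Variable P : op -> Prop.
Hypothesis P_abs : absorbing P.

Lemma abs_eq a b : a =1 b -> P a -> P b.
Proof. by move=> /functional_extensionality ->. Qed.

Lemma abs_scale c a : c != 0 -> P (fun f => c *: a f) -> P a.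
Proof.
move=> c0; have [_ PZ _] := P_abs; move/(PZ c^-1).
by apply: abs_eq => f; rewrite scalerA mulVf // scale1r.
Qed.

Lemma abs_perm s t m : perm_eq s t -> P (mo s m) -> P (mo t m).
Proof.
move=> /xs_perm[e He] Ps; apply: (abs_scale (c := (-1) ^+ e)).
  by rewrite signr_eq0.
by apply: abs_eq Ps => f; rewrite /mo He.
Qed.

Lemma abs_nuniq s m : ~~ uniq s -> P (mo s m).
Proof.
by move=> us; have [P0 _ _] := P_abs; apply: abs_eq P0 => f; rewrite /mo xs_nuniq.
Qed.

(* [v_j, x_j x_s v_m] = x_s v_m: the correction terms all carry a second x_j. *)
Lemma abs_strip j s m : Q (mo [::] j) -> j \notin s -> (j.+1 < m)%N ->
  P (mo (j :: s) m) -> P (mo s m).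
Proof.
move=> Qj js jm Pj; have [_ _ PB] := P_abs.
apply: abs_eq (PB _ _ _ _ Qj Pj (hom_mo [::] j) (hom_mo (j :: s) m)) => f.
rewrite br_mo //= cm_cons X_cm // subr0 dx_id X_xs0 ?X_ac //.
by rewrite scaler0 addr0.
Qed.

(** The bounds on s and t make each pivot supercommute with the letters of the other monomial, so
    only [v_m, v_n] survives. *)
Lemma abs_br_right m n s t : Q (mo s m) -> P (mo t n) ->
  all (gtn n) s -> all (gtn m) t -> P (fun f => xs s (xs t (ac m n f))).
Proof.
move=> Qs Pt sn tm; have [_ _ PB] := P_abs.
apply: (abs_scale (c := (-1) ^+ size t)); first by rewrite signr_eq0.
apply: abs_eq (PB _ _ _ _ Qs Pt (hom_mo s m) (hom_mo t n)) => f.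
by rewrite br_mo // cm_lt // linear0 add0r.
Qed.

Lemma abs_br_left m n s t : P (mo s m) -> Q (mo t n) ->
  all (gtn n) s -> all (gtn m) t -> P (fun f => xs s (xs t (ac m n f))).
Proof.
move=> Ps Qt sn tm; have [_ PZ PB] := P_abs.
apply: (abs_scale (c := (-1) ^+ size t)); first by rewrite signr_eq0.
have := PZ (- (-1) ^+ (~~ odd (size s) && ~~ odd (size t))) _
  (PB _ _ _ _ Qt Ps (hom_mo t n) (hom_mo s m)).
apply: abs_eq => f.
by rewrite -supBC br_mo // cm_lt // linear0 add0r.
Qed.

Lemma abs_next m s t : P (fun f => xs s (xs t (ac m m.+1 f))) ->
  P (mo (s ++ t ++ [:: m]) m.+3).
Proof.
move=> Pac; apply: (abs_scale (c := -1)); first by rewrite oppr_eq0 oner_neq0.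
by apply: abs_eq Pac => f; rewrite ac_next scaleN1r /mo !xs_cat !linearN.
Qed.

(** Here [v_m, v_{m+2}] = x_m x_{m+1} [v_{m+3}, v_{m+2}] = - x_m x_{m+1} x_{m+2} v_{m+5}, a gain of
    three consecutive letters. *)
Lemma abs_next2 m s t : P (fun f => xs s (xs t (ac m m.+2 f))) ->
  P (mo (s ++ t ++ [:: m; m.+1; m.+2]) m.+2.+3).
Proof.
move=> Pac; apply: (abs_scale (c := -1)); first by rewrite oppr_eq0 oner_neq0.
apply: abs_eq Pac => f.
by rewrite ac_far // acC ac_next scaleN1r /mo !xs_cat !linearN.
Qed.

End Absorbing.

(** The square of v_m is x_{m+1} v_{m+3}, and bracketing with v_{m+1} strips the letter. *)
Lemma Q_V m : Q (mo [::] m).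
Proof.
suff: [/\ Q (mo [::] m), Q (mo [::] m.+1) & Q (mo [::] m.+2)] by case.
elim: m => [|m [Q0 Q1 Q2]]; first by split; apply: Q_gen.
split=> //; apply: (abs_strip Q_abs Q1) => //.
apply: abs_eq (Q_sq Q0 (hom_mo [::] m)) => f.
exact: V_sq.
Qed.

Lemma Q_V_sq m : Q (mo [:: m.+1] m.+3).
Proof. by apply: abs_eq (Q_sq (Q_V m) (hom_mo [::] m)) => f; apply: V_sq. Qed.

Section AbsorbingFull.
Variable P : op -> Prop.
Hypothesis P_abs : absorbing P.

Lemma abs_strips t s m : uniq (t ++ s) -> all (fun j => j.+1 < m)%N t ->
  P (mo (t ++ s) m) -> P (mo s m).
Proof.
elim: t => //= j t IH /andP[jt uts] /andP[jm tm] Pj.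
exact/IH/(abs_strip P_abs (Q_V j) jt jm Pj).
Qed.

(** The letters missing from s are moved to the front and stripped one by one. *)
Lemma abs_sub n s : all (gtn n) s -> P (mo (iota 0 n) n.+2) -> P (mo s n.+2).
Proof.
move=> sn Pn; have [us|us] := boolP (uniq s); last exact: abs_nuniq.
pose t := [seq j <- iota 0 n | j \notin s].
have pt : perm_eq (iota 0 n) (t ++ s).
  apply: uniq_perm => [||x]; rewrite ?iota_uniq //.
    rewrite cat_uniq us filter_uniq ?iota_uniq // andbT.
    by apply/hasPn => x xs; rewrite mem_filter xs.
  rewrite mem_cat mem_filter; have [/(allP sn) xn|] := boolP (x \in s).
    by rewrite orbT mem_iota.
  by rewrite orbF.
apply: (abs_strips (t := t)); first by rewrite -(perm_uniq pt) iota_uniq.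
  by apply/allP => x; rewrite mem_filter mem_iota => /andP[_] /= ?; lia.
exact: abs_perm pt Pn.
Qed.

End AbsorbingFull.

(** Bracketing with v_n raises n by 3, so each residue class modulo 3 needs a start: n = 0 is v_2, n
    = 1 comes from [v_0, v_1], and the third class starts at n = 8. *)
Lemma Q_full n : (5 < n)%N -> Q (mo (iota 0 n) n.+2).
Proof.
have step k s : all (gtn k) s -> Q (mo s k.+2) ->
    Q (mo (s ++ [:: k; k.+1; k.+2]) k.+2.+3).
  move=> sk Qs; apply: (abs_next2 Q_abs (s := [::])).
  exact: (abs_br_right Q_abs (Q_V k) Qs).
have Qf3 k : Q (mo (iota 0 k) k.+2) -> Q (mo (iota 0 k.+3) k.+3.+2).
  move=> Qk; rewrite -[k.+3]addn3 iotaD addn3; apply: step Qk.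
  by apply/allP => x; rewrite mem_iota.
have Q0 : Q (mo (iota 0 0) 2) by apply: Q_V.
have Q1 : Q (mo (iota 0 1) 3).
  by apply: (abs_next Q_abs (s := [::]) (t := [::])
    (abs_br_right Q_abs (Q_V 0) (Q_V 1) _ _)).
(* From x_1 v_4 one gets x_1 x_2 x_3 x_4 v_7, hence x_3 x_4 v_7; its bracket with x_0 x_1 x_2 v_5 is
   x_0 ... x_7 v_10 up to sign. *)
have Q8 : Q (mo (iota 0 8) 10).
  have q1 : Q (mo [:: 1%N] 4).
    by apply: (abs_next Q_abs (s := [::]) (t := [::])
    (abs_br_right Q_abs (Q_V 1) (Q_V 2) _ _)).
  have q2 : Q (mo [:: 3; 4]%N 7).
    exact: (abs_strips Q_abs (t := [:: 1; 2]%N) _ _ (step 2%N [:: 1%N] _ q1)).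
  exact: (abs_next2 Q_abs (abs_br_right Q_abs (Qf3 0%N Q0) q2 _ _)).
suff: forall k, [/\ Q (mo (iota 0 k.+3.+3) k.+3.+3.+2),
   Q (mo (iota 0 k.+4.+3) k.+4.+3.+2) & Q (mo (iota 0 k.+4.+4) k.+4.+4.+2)].
  move=> H n5; have [+ _ _] := H (n - 6)%N.
  by have -> : (n - 6).+3.+3 = n by lia.
elim=> [|k [H1 H2 H3]]; last by split=> //; apply: Qf3.
by split; [apply/Qf3/Qf3 | apply/Qf3/Qf3 | ].
Qed.

Lemma Q_type1 n s : (5 < n)%N -> all (gtn n) s -> Q (mo s n.+2).
Proof. by move=> n5 sn; apply: (abs_sub Q_abs) => //; apply: Q_full. Qed.

(** * Finite Grassmann algebras of coefficients, and brackets with bounded operators *)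

Lemma coef_linear B p a : span (coef B p) a -> linear a.
Proof. by apply: span_linear => _ [l [_ _ ->]]; apply: xs_is_linear. Qed.

Lemma coef_hom B p a : span (coef B p) a -> hom p a.
Proof. by apply: hom_span => _ [l [_ <- ->]] q f; apply: gr_xs. Qed.

Lemma coef_split B p a : span (coef B.+1 p) a -> exists b b',
  [/\ span (coef B p) b, span (coef B (~~ p)) b' & forall f, a f = b f + X B (b' f)].
Proof.
elim=> [|c _ a' [l [lB <- ->]] _ [b [b' [Sb Sb' e]]]].
  exists (fun=> 0), (fun=> 0); split; try exact: span0.
  by move=> f; rewrite linear0 addr0.
have {lB} [d [d' [Sd Sd' ed]]] : exists d d', [/\ span (coef B (odd (size l))) d,
    span (coef B (~~ odd (size l))) d' & forall f, xs l f = d f + X B (d' f)].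
  elim: l lB {Sb Sb'} => [_|i l IH /= /andP[iB /IH[d [d' [Sd Sd' ed]]]]].
    exists id, (fun=> 0); split; last by move=> f; rewrite linear0 addr0.
      by apply: span_gen; exists [::]; split=> //; apply: functional_extensionality.
    exact: span0.
  have [iB'|Bi] := ltnP i B.
    exists (fun f => X i (d f)), (fun f => - X i (d' f)).
    split; [exact: coef_X| exact/spanN/coef_X | move=> f].
    by rewrite ed linearD linearN /= X_anti.
  have -> : i = B by move: iB => /=; lia.
  exists (fun=> 0), d; split; [exact: span0 | by rewrite negbK | move=> f].
  by rewrite ed linearD /= X_sq addr0 add0r.
exists (fun f => c *: d f + b f), (fun f => c *: d' f + b' f); split.
- exact/spanD/Sb/spanZ.
- exact/spanD/Sb'/spanZ.
by move=> f; rewrite e ed linearP scalerDr addrACA.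
Qed.

Lemma iota_snoc_sign B : exists e : nat, forall f,
  X B (xs (iota 0 B) f) = (-1) ^+ e *: xs (iota 0 B.+1) f.
Proof.
have pB : perm_eq (B :: iota 0 B) (iota 0 B.+1).
  by rewrite -addn1 iotaD cats1 perm_sym perm_rcons.
by have [e He] := xs_perm pB; exists e.
Qed.

(** A nonzero element of a finite Grassmann algebra divides the top monomial. With a = b + x_B b',
    multiply by x_B if b is nonzero, and otherwise continue with b'. *)
Lemma coef_top B p a f0 : span (coef B p) a -> a f0 <> 0 ->
  exists t c, [/\ all (gtn B) t, c != 0 &
                  forall f, xs t (a f) = c *: xs (iota 0 B) f].
Proof.
elim: B p a f0 => [|B IH] p a f0 Sa a0.
  have [c ac0] : exists c, forall f, a f = c *: f.
    elim: Sa => [|c _ b [[|i l] [//= lB _ ->]] _ [d bd]].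
      by exists 0 => f; rewrite scale0r.
    by exists (c + d) => f; rewrite bd scalerDl.
  exists [::], c; split=> [//||f /=]; last exact: ac0.
  by apply/eqP => c0; apply: a0; rewrite ac0 c0 scale0r.
have [b [b' [Sb Sb' e]]] := coef_split Sa.
have [d Hd] := iota_snoc_sign B.
have sub t : all (gtn B) t -> all (gtn B.+1) t.
  by apply: sub_all => x /= /ltnW.
case: (classic (exists f, b f <> 0)) => [[f bf]|b0].
  have [t [c [tB c0 Hc]]] := IH _ _ _ Sb bf.
  exists (B :: t), (c * (-1) ^+ d); split; first by rewrite /= ltnSn sub.
    by rewrite mulf_neq0 ?signr_eq0.
  move=> h; rewrite e /= linearD linearD /= Hc linearZ /= Hd scalerA.
  by rewrite X_xs0 ?X_sq // addr0.
have {}b0 f : b f = 0 by apply: NNPP => bf; apply: b0; exists f.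
have b'f : b' f0 <> 0 by move=> b'0; apply: a0; rewrite e b0 b'0 linear0 addr0.
have [t [c [tB c0 Hc]]] := IH _ _ _ Sb' b'f.
exists t, ((-1) ^+ size t * c * (-1) ^+ d); split; first exact: sub.
  by rewrite !mulf_neq0 ?signr_eq0.
by move=> h; rewrite e b0 add0r xs_X Hc linearZ /= Hd !scalerA.
Qed.

Lemma coef_V B p a m f : (B <= m)%N -> span (coef B p) a ->
  V m (a f) = (-1) ^+ p *: a (V m f).
Proof.
move=> Bm; elim=> [|c _ b [l [lB <- ->]] _ IH]; first by rewrite linear0 scaler0.
rewrite linearP IH V_xs; last by apply: sub_all lB => x /= ?; lia.
by rewrite signr_odd scalerDr !scalerA mulrC.
Qed.

Lemma coef_xs B p a t f : span (coef B p) a ->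
  a (xs t f) = (-1) ^+ (p && odd (size t)) *: xs t (a f).
Proof.
elim=> [|c _ b [l [lB <- ->]] _ IH]; first by rewrite linear0 scaler0.
by rewrite linearP IH xs_xs -oddM signr_odd scalerDr !scalerA mulrC.
Qed.

(** Looser than [gen]: letters and pivot index are only bounded by N, so the family is finite up to
    repeated letters and grows with N. *)
Definition bnd N p (a : op) :=
  exists s m, [/\ all (gtn N) s, (m < N)%N, p = ~~ odd (size s) & a = mo s m].

Lemma bnd_le N N' p a : (N <= N')%N -> span (bnd N p) a -> span (bnd N' p) a.
Proof.
move=> NN'; apply: span_sub => b [s [m [sN mN -> ->]]]; apply: span_gen.
exists s, m; split=> //; last exact: leq_trans NN'.
by apply: sub_all sN => x /= xN; apply: leq_trans NN'.
Qed.

Lemma gen_bnd N p n a : (n < N)%N -> gen p n a -> span (bnd N p) a.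
Proof.
move=> nN /gen_mo[c [s [sn -> ->]]]; apply: spanZ; apply: span_gen.
by exists s, n; split=> //; apply: sub_all sn => x /= ?; lia.
Qed.

Lemma W_bnd p a : W p a -> exists N, span (bnd N p) a.
Proof.
elim=> [|c b b' [n gb] _ [N Sb']]; first by exists 0%N; apply: span0.
exists (maxn N n.+1); apply: spanD (bnd_le (leq_maxl _ _) Sb').
exact/spanZ/(bnd_le (leq_maxr _ _) (gen_bnd (ltnSn n) gb)).
Qed.

Lemma bnd_one N p a : span (bnd N p) a -> a one = 0.
Proof.
elim=> [//|c _ b [s [m [_ _ _ ->]]] _ ->].
by rewrite /mo V_one linear0 scaler0 addr0.
Qed.

(** The supercommutator [a, x_t] for a of parity p. By [cmo_span] it is a multiplication operator
    when a is bounded; a kills [one], so it multiplies by a(x_t). *)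
Definition cmo p t (a : op) : op :=
  fun f => a (xs t f) - (-1) ^+ (p && odd (size t)) *: xs t (a f).

Lemma cmo_mo s m t f : cmo (~~ odd (size s)) t (mo s m) f = xs s (cm m t f).
Proof.
rewrite /cmo /mo /cm linearB /= xsZ (xs_xs t s) scalerA; congr (_ - _ *: _).
rewrite -(signr_odd _ (size t)) -(signr_odd _ (_ * _)) oddM.
by case: (odd (size s)); case: (odd (size t)); rewrite /= ?(mul1r, mulr1, expr0).
Qed.

Lemma cmo_span N B p t a : (N <= B)%N -> all (gtn B) t -> span (bnd N p) a ->
  span (coef B (p (+) odd (size t))) (cmo p t a).
Proof.
move=> NB tB; apply: (span_map (F := cmo p t)) => [f|c b b' f|_ [s [m [sN mN -> ->]]]].
- by rewrite /cmo linear0 scaler0 subr0.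
- rewrite /cmo linearP scalerDr opprD addrACA scalerBr; congr (_ - _ + _).
  by rewrite !scalerA mulrC.
apply: span_eq (fun f => esym (cmo_mo s m t f)) _.
apply: (span_comp (w := id)) (cm_span m tB) => [|_ [l [lB ol ->]]].
  exact: xs_is_linear.
apply: span_gen; exists (s ++ l); split.
- by rewrite all_cat lB andbT; apply: sub_all sN => x /= ?; lia.
- by rewrite size_cat oddD ol addbN addNb.
by apply: functional_extensionality => f; rewrite xs_cat.
Qed.

(** Each use of [ac_far] raises m by 3 and puts x_m x_{m+1} in front. The first m reached with m >=
    N is below N + 3, so x_m is already a letter of t. *)
Lemma xs_ac0 N t m k f : (forall j, (N <= j < N.+3)%N -> j \in t) ->
  (m < N.+3)%N -> (N.+4 < k)%N -> xs t (ac m k f) = 0.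
Proof.
move=> tN mN Nk; have [d] := ubnP (N - m)%N; elim: d m mN => // d IH m mN le_d.
rewrite ac_far; last by lia.
have [Nm|Nm] := leqP N m; first by rewrite xs_mem0r // tN // Nm.
by rewrite !xs_X IH ?linear0 ?scaler0 //; lia.
Qed.

Lemma bnd_ac0 N p t k a f : (forall j, (N <= j < N.+3)%N -> j \in t) ->
  (N.+4 < k)%N -> span (bnd N p) a ->
  xs t (a (V k f)) = (-1) ^+ p *: xs t (V k (a f)).
Proof.
move=> tN Nk; elim=> [|c _ b [s [m [sN mN -> ->]]] _ IH].
  by rewrite !linear0 ?scaler0.
rewrite (linearP (V k)) !(xs_is_linear t) IH scalerDr; congr (_ + _).
rewrite !scalerA [_ * c]mulrC -scalerA; congr (_ *: _).
have -> : mo s m (V k f) = xs s (ac m k f) - xs s (V k (V m f)).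
  by rewrite /ac linearD /= addrK.
rewrite (linearB (xs t)) /= xs_xs (@xs_ac0 N) ?linear0 ?scaler0 ?sub0r //; last by lia.
rewrite /mo V_xs; last by apply: sub_all sN => x /= ?; lia.
by rewrite xsZ scalerA -(signr_odd _ (size s)) -signr_addb addNb addbb expr1 scaleN1r.
Qed.

(** In the Leibniz expansion of [a, x_t v_k] the term x_t [a, v_k] vanishes, because t contains N, N
    + 1 and N + 2. *)
Lemma br_bnd N p t k a f : (forall j, (N <= j < N.+3)%N -> j \in t) ->
  (N.+4 < k)%N -> span (bnd N p) a ->
  supB p (~~ odd (size t)) a (mo t k) f = cmo p t a (V k f).
Proof.
move=> tN Nk Sa; rewrite /supB /cmo (bnd_ac0 f tN Nk Sa) scalerA -signr_addb.
by rewrite /mo; congr (_ - _ ^+ _ *: _); case: p {Sa}; case: odd.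
Qed.

(** * A nonzero homogeneous element forces all pivots of large index into the ideal *)

Section Ideal.
Variable I : op -> Prop.
Hypothesis I_abs : absorbing I.
Hypothesis I_add : forall a b, I a -> I b -> I (fun f => a f + b f).
Hypothesis I_sq : forall a, I a -> hom true a -> I (fun f => a (a f)).

(** Choose t with x_t a = c x_0 ... x_{n-1}. Bracketing x_t v_{n+3} with a v_{n+2} gives, up to a
    nonzero scalar, x_0 ... x_{n-1} x_{n+2} v_{n+5}, whose letters are then stripped. *)
Lemma ideal_coef_V n p a f0 : (5 < n)%N -> span (coef n p) a -> a f0 <> 0 ->
  I (fun f => a (V n.+2 f)) -> I (mo [::] n.+2.+3).
Proof.
move=> n5 Sa a0 Ia; have [t [c [tn c0 Hc]]] := coef_top Sa a0.
have Qt : Q (mo t n.+3).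
  by apply: (Q_type1 (n := n.+1)); [exact: ltnW | apply: sub_all tn => x /= ?; lia].
have ha : hom (~~ p) (fun f => a (V n.+2 f)).
  by move=> q f qf; rewrite addbN -addNb; apply/(coef_hom Sa)/gr_V.
have [_ _ IB] := I_abs.
suff: I (mo (iota 0 n ++ [:: n.+2]) n.+2.+3).
  rewrite -[iota 0 n ++ _]cats0; apply: (abs_strips I_abs).
    by rewrite cats0 cats1 rcons_uniq iota_uniq mem_iota /=; lia.
  by rewrite all_cat /=; apply/andP; split; [apply/allP => x; rewrite mem_iota /=|]; lia.
apply: (abs_next I_abs (t := [::])) => /=.
apply: (abs_scale I_abs (c := (-1) ^+ p * c)).
  by rewrite mulf_neq0 ?signr_eq0.
apply: abs_eq (IB _ _ _ _ Qt Ia (hom_mo t n.+3) ha) => f.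
rewrite /supB /mo (coef_V _ _ Sa); last by lia.
rewrite V_xs; last by apply: sub_all tn => x /= ?; lia.
have la := coef_linear Sa.
have laZ d h : a (d *: h) = d *: a h.
  by rewrite -[d *: h]addr0 la (linear_fun0 la) addr0.
rewrite laZ (coef_xs _ _ Sa) xsZ Hc Hc !scalerA -scalerA /ac linearD scalerDr addrC /=.
congr (_ + _); last by rewrite scalerA.
rewrite -scaleNr; congr (_ *: _); rewrite -mulNr; congr (_ * _).
rewrite -(signr_odd _ (size t)).
by case: odd; case: (p); rewrite /= ?(expr0, expr1, mulr1, mul1r, mulrN1, opprK).
Qed.

Lemma ideal_V p a : I a -> W p a -> (exists f, a f <> 0) ->
  exists M, forall n, (M <= n)%N -> I (mo [::] n).
Proof.
move=> Ia Wa [f af]; have la := W_linear Wa.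
have [s as0] : exists s, a (xs s one) <> 0.
  by apply: NNPP => h; apply/af/op_ext => // s; apply: NNPP => ?; apply: h; exists s.
have [N0 Sa0] := W_bnd Wa; pose N := maxn N0 (\max_(j <- s) j).+1.
have sN : all (gtn N) s.
  apply/allP => j js /=; rewrite /N leq_max ltnS; apply/orP; right.
  exact: leq_bigmax_seq.
have Sa : span (bnd N p) a := bnd_le (leq_maxl _ _) Sa0.
have one0 := bnd_one Sa.
(* The final bracket turns v_{k+2} into v_{k+5} = v_n. The bound gives k >= N + 6, which leaves room
   for N, N + 1, N + 2 below k and makes k > 5. *)
exists (N + 11)%N => n Nn; pose k := (n - 5)%N.
have -> : n = k.+2.+3 by rewrite /k; lia.
pose u := iota N (k - N).
have uk : all (gtn k) u by apply/allP => x; rewrite mem_iota /= /k; lia.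
have sk : all (gtn k) s by apply: sub_all sN => x /= ?; rewrite /k; lia.
have [t [tk tN at0]] : exists t, [/\ all (gtn k) t,
    forall j, (N <= j < N.+3)%N -> j \in t & a (xs t one) <> 0].
  have uN j : (N <= j < N.+3)%N -> j \in u by rewrite mem_iota /k; lia.
  (* If a(x_u) = 0, then a(x_s x_u) = [a, x_s] x_u. The coefficient [a, x_s] is nonzero in x_0, ...,
     x_{N-1} and divides their product, while u uses only letters from N on, so the value is
     nonzero. *)
  have [au0|/eqP au0] := eqVneq (a (xs u one)) 0; last by exists u.
  exists (s ++ u); split=> [|j /uN ju|]; first by rewrite all_cat sk.
    by rewrite mem_cat ju orbT.
  have c0 : cmo p s a one <> 0 by rewrite /cmo one0 linear0 scaler0 subr0.
  have [r [c [rN cn0 Hc]]] := coef_top (cmo_span (leqnn N) sN Sa) c0.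
  have -> : a (xs (s ++ u) one) = cmo p s a (xs u one).
    by rewrite /cmo au0 linear0 scaler0 subr0 xs_cat.
  move=> /(congr1 (xs r)); rewrite Hc linear0 -xs_cat => /eqP.
  rewrite scaler_eq0 (negbTE cn0) => /eqP; apply: xs_one.
  rewrite cat_uniq !iota_uniq andbT /=; apply/hasPn => x.
  by rewrite !mem_iota /=; lia.
have Nk : (N <= k)%N by rewrite /k; lia.
apply: (ideal_coef_V (f0 := one) _ (cmo_span Nk tk Sa)) => [||].
- by rewrite /k; lia.
- by rewrite /cmo one0 linear0 scaler0 subr0.
(* The bracket of a with x_t v_{k+2} lies in I and equals [a, x_t] v_{k+2}. *)
have Qt : Q (mo t k.+2) by apply: Q_type1 => //; rewrite /k; lia.
have [_ IZ IB] := I_abs.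
have := IZ (- (-1) ^+ (p && ~~ odd (size t))) _
  (IB _ _ _ _ Qt Ia (hom_mo t k.+2) (W_hom Wa)).
apply: abs_eq => h; rewrite -supBC; apply: br_bnd tN _ Sa.
by rewrite /k; lia.
Qed.

(** * All spanning monomials of large index lie in the ideal *)

Section Tail.
Variable M : nat.
Hypothesis I_V : forall n, (M <= n)%N -> I (mo [::] n).

(** Bracketing v_{n-3} in I with x_0 ... x_{n-4} v_{n-1} in Q gives x_0 ... x_{n-1} v_{n+2} up to
    sign. *)
Lemma ideal_type1 n s : (M + 9 <= n)%N -> all (gtn n) s -> I (mo s n.+2).
Proof.
move=> Mn sn; apply: (abs_sub I_abs sn).
have -> : n = (n - 3).+3 by lia.
rewrite -[X in iota 0 X]addn3 iotaD /=.
apply: (abs_next2 I_abs (s := [::])).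
apply: (abs_br_left I_abs) => //; first by apply: I_V; lia.
  by apply: Q_full; lia.
by apply/allP => x; rewrite mem_iota.
Qed.

Lemma ideal_gen p n g : (M + 20 <= n)%N -> gen p n g -> I g.
Proof.
move=> Mn gg; case: gg Mn => {p n g} [s m sm|s m sm|m] Mm.
- have -> : m = (m - 2).+2 by lia.
  by apply: ideal_type1; [lia | apply: sub_all sm => x /= ?; lia].
- have key r : perm_eq r s -> I (fun f => xs r (ac m m f)) ->
      I (fun f => 2%:R *: mo (m.+1 :: s) m.+3 f).
    move=> /xs_perm[e He] Ir; apply: (abs_scale I_abs (c := (-1) ^+ e * (-1) ^+ size s)).
      by rewrite mulf_neq0 ?signr_eq0.
    apply: abs_eq Ir => f; rewrite ac_id He xsZ xs_X !scalerA.
    by rewrite -!mulrA [2%:R * _]mulrC.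
  have [_ IZ _] := I_abs.
  have [us|us] := boolP (uniq s); last first.
    by apply/IZ/(abs_nuniq I_abs); rewrite /= negb_and us orbT.
  (* The monomial comes from x_s [v_m, v_m]. A letter m - 2 in s is too large for [ideal_type1]; it
     is given to the factor in Q, since x_{m-2} v_m = v_{m-3}^2. *)
  pose k := (m - 2)%N; have mk : m = k.+2 by rewrite /k; lia.
  have [ks|ks] := boolP (k \in s).
    apply: (key (k :: rem k s)); first by rewrite perm_sym perm_to_rem.
    apply: (abs_br_right I_abs (s := [:: k])).
    + have := Q_V_sq (m - 3); have -> : (m - 3).+1 = k by rewrite /k; lia.
      by rewrite -mk.
    + rewrite mk; apply: ideal_type1; first by rewrite /k; lia.
      apply/allP => x; rewrite mem_rem_uniq // inE => /andP[xk /(allP sm)].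
      by move: xk; rewrite /k /=; lia.
    + by rewrite /= mk; lia.
    by apply/allP => x /mem_rem /(allP sm) /=; lia.
  apply: (key s) => //; apply: (abs_br_right I_abs (s := [::])) => //.
  + exact: Q_V.
  + rewrite mk; apply: ideal_type1; first by rewrite /k; lia.
    apply/allP => x xs'; have := allP sm _ xs'.
    have : x != k by apply: contraNneq ks => <-.
    by rewrite /k /=; lia.
  by apply: sub_all sm => x /= ?; lia.
apply: abs_eq (I_sq (I_V (n := m) _) (hom_mo [::] m)) => [f|]; last by lia.
exact: V_sq.
Qed.

Lemma ideal_tail p a : W p a -> exists u b,
  [/\ I u, span (bnd (M + 20) p) b & forall f, a f = u f + b f].
Proof.
have [I0 IZ _] := I_abs.
elim=> [|c g b [n gg] _ [u [b' [Iu Sb' e]]]].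
  by exists (fun=> 0), (fun=> 0); split=> // [|f]; [exact: span0 | rewrite addr0].
have [Mn|nM] := leqP (M + 20) n.
  exists (fun f => c *: g f + u f), b'; split=> // [|f]; last by rewrite e addrA.
  exact/I_add/Iu/IZ/(ideal_gen Mn gg).
exists u, (fun f => c *: g f + b' f); split=> // [|f]; last by rewrite e addrCA.
exact/spanD/Sb'/spanZ/(gen_bnd nM gg).
Qed.

End Tail.
End Ideal.

End PivotAlgebra.

(** * Pivots as pointwise limits of finite truncations *)

Section Truncation.
Variables (K : fieldType) (L : lmodType K) (X D : nat -> {linear L -> L}).
Variable v : nat -> L -> L.
Implicit Types (f : L) (i j m n : nat).

(** The first n terms of v_i, arranged as v_i = d_i + x_i x_{i+1} v_{i+3}. Identities are proved by
    induction on n, then transferred by taking n large for all the vectors involved. *)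
Fixpoint pvn n i f : L :=
  if n is n'.+1 then D i f + X i (X i.+1 (pvn n' i.+3 f)) else 0.

Lemma pvn_sum n i f : pvn n i f = \sum_(k < n)
  foldr (fun n h => X (i + 3 * n)%N (X (i + 3 * n).+1 h)) (D (i + 3 * k)%N f) (iota 0 k).
Proof.
elim: n i => [|n IH] i; first by rewrite big_ord0.
rewrite big_ord_recl /= muln0 addn0 IH; congr (_ + _).
rewrite (linear_sum (X i.+1)) (linear_sum (X i)); apply: eq_bigr => k _ /=.
rewrite (iotaDl 1 0) foldr_map; congr (X _ (X _ _)).
have -> : (i + 3 * bump 0 k = i.+3 + 3 * k)%N by rewrite /bump; lia.
elim: (iota 0 k) => //= m s ->.
by have -> : (i + 3 * (1 + m) = i.+3 + 3 * m)%N by lia.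
Qed.

Lemma pvn_trunc N n i f : (forall j, (N <= j)%N -> D j f = 0) -> (N <= n)%N ->
  \sum_(k < N) foldr (fun n h => X (i + 3 * n)%N (X (i + 3 * n).+1 h))
    (D (i + 3 * k)%N f) (iota 0 k) = pvn n i f.
Proof.
move=> Df Nn; rewrite pvn_sum.
rewrite (big_ord_widen n (fun k => foldr (fun n h => X (i + 3 * n)%N (X (i + 3 * n).+1 h))
    (D (i + 3 * k)%N f) (iota 0 k)) Nn) big_mkcond.
apply: eq_bigr => k _; case: ifP => // /negbT; rewrite -leqNgt => Nk.
rewrite Df; last by lia.
by elim: (iota 0 k) => //= m s <-; rewrite !linear0.
Qed.

Hypothesis v_pvn : forall f, exists N, forall n i, (N <= n)%N -> v i f = pvn n i f.
Hypothesis X_anti : forall i j f, X i (X j f) = - X j (X i f).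
Hypothesis D_X_neq : forall i j f, i != j -> D i (X j f) = - X j (D i f).
Hypothesis D_anti : forall i j f, i != j -> D i (D j f) = - D j (D i f).

Lemma pvn_linear n i : linear (pvn n i).
Proof.
elim: n i => [|n IH] i c f g /=; first by rewrite scaler0 addr0.
by rewrite IH !linearP scalerDr addrACA.
Qed.

Lemma v_linear i : linear (v i).
Proof.
move=> c f g; have [N Nf] := v_pvn f; have [N' Ng] := v_pvn g.
have [N'' Nfg] := v_pvn (c *: f + g).
pose n := (N + N' + N'')%N.
by rewrite (Nf n) ?(Ng n) ?(Nfg n) ?pvn_linear // /n; lia.
Qed.

Lemma v_rec i f : v i f = D i f + X i (X i.+1 (v i.+3 f)).
Proof. by have [N Nf] := v_pvn f; rewrite (Nf N.+1) // (Nf N). Qed.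

Lemma pvn_X n i j f : (j < i)%N -> pvn n i (X j f) = - X j (pvn n i f).
Proof.
elim: n i => [|n IH] i ji /=; first by rewrite linear0 oppr0.
rewrite IH; last by lia.
rewrite D_X_neq; last by lia.
rewrite linearD opprD !linearN; congr (_ - _) => /=.
by rewrite (X_anti i.+1 j) linearN /= (X_anti i j) opprK.
Qed.

Lemma v_X i j f : (j < i)%N -> v i (X j f) = - X j (v i f).
Proof.
move=> ji; have [[N Nf] [N' Nj]] := conj (v_pvn f) (v_pvn (X j f)).
by rewrite (Nf (N + N')%N) ?(Nj (N + N')%N) ?pvn_X //; lia.
Qed.

Lemma pvn_D n i j f : (j < i)%N -> pvn n i (D j f) = - D j (pvn n i f).
Proof.
elim: n i => [|n IH] i ji /=; first by rewrite linear0 oppr0.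
rewrite IH; last by lia.
rewrite D_anti; last by lia.
rewrite linearD opprD !linearN; congr (_ - _) => /=.
by rewrite !D_X_neq ?linearN /= ?opprK //; lia.
Qed.

Lemma v_D i j f : (j < i)%N -> v i (D j f) = - D j (v i f).
Proof.
move=> ji; have [[N Nf] [N' Nj]] := conj (v_pvn f) (v_pvn (D j f)).
by rewrite (Nf (N + N')%N) ?(Nj (N + N')%N) ?pvn_D //; lia.
Qed.

Lemma v_eq0 i f : (forall j, D j f = 0) -> v i f = 0.
Proof.
move=> Df; have [N Nf] := v_pvn f; rewrite (Nf N) //.
by elim: N i {Nf} => //= n IH i; rewrite Df IH !linear0 addr0.
Qed.

Lemma v_gr (gr : bool -> L -> Prop) : (forall p, gr p 0) ->
  (forall p f g, gr p f -> gr p g -> gr p (f + g)) ->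
  (forall p i f, gr p f -> gr (~~ p) (X i f)) ->
  (forall p i f, gr p f -> gr (~~ p) (D i f)) ->
  forall p i f, gr p f -> gr (~~ p) (v i f).
Proof.
move=> gr0 grD grX grDop p i f pf; have [N Nf] := v_pvn f; rewrite (Nf N) // {Nf}.
elim: N i => [|n IH] i /=; first exact: gr0.
by apply: grD; [apply: grDop | rewrite -[~~ p]negbK; apply/grX/grX/IH].
Qed.

End Truncation.

(** * The concrete Grassmann algebra satisfies the abstract relations *)

Section Grassmann.
Variable K : fieldType.
Notation Lam := (Lam K).
Notation Op := (Op K).
Implicit Types (f g h : Lam) (i j k m n : nat) (s t l : seq nat).
Implicit Types (S T : {fset nat}) (B : {fset nat} -> Lam) (a b : Op).

Lemma linextEw B (d : {fset {fset nat}}) f : msupp f `<=` d ->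
  linext B f = \sum_(S <- d) f@_S *: B S.
Proof.
move=> sd; apply: big_fset_incl => // S _ Sf.
by rewrite mcoeff_outdom // scale0r.
Qed.

Lemma linext_is_linear B : linear (linext B).
Proof.
move=> c f g; pose d := msupp f `|` msupp g.
have sf : msupp f `<=` d by apply: fsubsetUl.
have sg : msupp g `<=` d by apply: fsubsetUr.
have sfg : msupp (c *: f + g) `<=` d.
  apply: fsubset_trans (msuppD_le _ _) _.
  by apply: fsetSU; apply: msuppZ_le.
rewrite !(linextEw B sf) !(linextEw B sg) (linextEw B sfg).
rewrite scaler_sumr -big_split /=; apply: eq_bigr => S _.
by rewrite mcoeffD mcoeffZ scalerDl scalerA.
Qed.

HB.instance Definition _ i :=
  GRing.isLinear.Build K Lam Lam _ (@xop K i) (linext_is_linear (lmulB K i)).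
HB.instance Definition _ i :=
  GRing.isLinear.Build K Lam Lam _ (@dop K i) (linext_is_linear (derB K i)).

Lemma linext_mon B S : linext B (mon K S) = B S.
Proof.
by rewrite /linext /mon msuppU oner_eq0 big_seq_fset1 mcoeffUU scale1r.
Qed.

Lemma xop_mon i S : xop i (mon K S) = lmulB K i S.
Proof. exact: linext_mon. Qed.

Lemma dop_mon i S : dop i (mon K S) = derB K i S.
Proof. exact: linext_mon. Qed.

Lemma monE f : f = \sum_(S <- msupp f) f@_S *: mon K S.
Proof.
rewrite [LHS]monalgE; apply: eq_bigr => S _.
by apply/malgP => T; rewrite mcoeffZ !mcoeffU mulrnAr mulr1.
Qed.

Lemma linear_mon (a b : {linear Lam -> Lam}) :
  (forall S, a (mon K S) = b (mon K S)) -> a =1 b.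
Proof.
move=> ab f; rewrite [f]monE !linear_sum.
by apply: eq_bigr => S _; rewrite !linearZ /= ab.
Qed.

Definition Xl i : {linear Lam -> Lam} := xop i.
Definition Dl i : {linear Lam -> Lam} := dop i.

Lemma xop_anti i j f : Xl i (Xl j f) = - Xl j (Xl i f).
Proof. exact: (X_anti linear_mon xop_mon). Qed.

Lemma xop_sq i f : Xl i (Xl i f) = 0.
Proof. exact: (X_sq linear_mon xop_mon). Qed.

Lemma dop_xop i f : Dl i (Xl i f) = f - Xl i (Dl i f).
Proof. exact: (D_X linear_mon xop_mon dop_mon). Qed.

Lemma dop_xop_neq i j f : i != j -> Dl i (Xl j f) = - Xl j (Dl i f).
Proof. exact: (D_X_neq linear_mon xop_mon dop_mon). Qed.

Lemma dop_anti i j f : i != j -> Dl i (Dl j f) = - Dl j (Dl i f).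
Proof. exact: (D_anti linear_mon dop_mon). Qed.

Lemma dop_sq i f : Dl i (Dl i f) = 0.
Proof. exact: (D_sq linear_mon dop_mon). Qed.

Lemma dop_maxidx j f : (maxidx f < j)%N -> dop j f = 0.
Proof.
move=> fj; rewrite /dop /linext big_seq big1 // => S Sf; rewrite /derB.
case: ifP => [jS|_]; last exact: scaler0.
suff: (j <= maxidx f)%N by rewrite leqNgt fj.
rewrite /maxidx; apply: leq_trans (leq_bigmax_seq _ Sf isT) => /=.
exact: leq_bigmax_seq.
Qed.

Lemma pivot_pvn f : exists N, forall n i, (N <= n)%N -> pivot i f = pvn Xl Dl n i f.
Proof.
exists (maxidx f).+1 => n i; apply: (@pvn_trunc K Lam Xl Dl) => j.
exact: dop_maxidx.
Qed.

HB.instance Definition _ i :=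
  GRing.isLinear.Build K Lam Lam _ (@pivot K i) (v_linear pivot_pvn i).

Definition Vl i : {linear Lam -> Lam} := pivot i.

Definition gr p f := forall T, parity T != p -> f@_T = 0.

Lemma gr0 p : gr p 0.
Proof. by move=> T _; rewrite mcoeff0. Qed.

Lemma grD p f g : gr p f -> gr p g -> gr p (f + g).
Proof. by move=> pf pg T pT; rewrite mcoeffD pf // pg // addr0. Qed.

Lemma grZ p c f : gr p f -> gr p (c *: f).
Proof. by move=> pf T pT; rewrite mcoeffZ pf // mulr0. Qed.

Lemma gr_disj p f : gr p f -> gr (~~ p) f -> f = 0.
Proof.
move=> pf npf; apply/malgP => T; rewrite mcoeff0.
by have [pT|pT] := eqVneq (parity T) p; [apply: npf; rewrite pT; case: (p) | apply: pf].
Qed.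

Lemma gr_mon S : gr (parity S) (mon K S).
Proof.
move=> T TS; rewrite /mon mcoeffU; case: eqP => // ST.
by rewrite ST eqxx in TS.
Qed.

Lemma gr_msupp p f S : gr p f -> S \in msupp f -> parity S = p.
Proof.
move=> pf; rewrite -mcoeff_neq0; have [//|pS] := eqVneq (parity S) p.
by rewrite pf // eqxx.
Qed.

Lemma gr_sum p (r : seq {fset nat}) (P : pred {fset nat}) (F : {fset nat} -> Lam) :
  (forall S, S \in r -> P S -> gr p (F S)) -> gr p (\sum_(S <- r | P S) F S).
Proof.
move=> H; rewrite big_seq_cond; apply: (big_ind (gr p)).
- exact: gr0.
- exact: grD.
by move=> S /andP[]; apply: H.
Qed.

Lemma gr_linext B q p f : (forall S, gr (parity S (+) q) (B S)) -> gr p f ->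
  gr (p (+) q) (linext B f).
Proof.
move=> HB pf; apply: gr_sum => S Sf _; apply: grZ.
by rewrite -(gr_msupp pf Sf).
Qed.

Lemma gr_X p i f : gr p f -> gr (~~ p) (Xl i f).
Proof.
rewrite -addbT; apply: gr_linext => S; rewrite /lmulB addbT.
case: ifP => [_|/negbT iS]; first exact: gr0.
apply: grZ; have <- : parity (i |` S) = ~~ parity S by rewrite /parity cardfsU1 iS.
exact: gr_mon.
Qed.

Lemma gr_D p i f : gr p f -> gr (~~ p) (Dl i f).
Proof.
rewrite -addbT; apply: gr_linext => S; rewrite /derB addbT.
case: ifP => [iS|_]; last exact: gr0.
apply: grZ; have <- : parity (S `\ i) = ~~ parity S.
  by rewrite /parity (cardfsD1 i S) iS /= negbK.
exact: gr_mon.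
Qed.

Lemma gr_V p m f : gr p f -> gr (~~ p) (Vl m f).
Proof. exact: (v_gr pivot_pvn gr0 grD gr_X gr_D). Qed.

Definition one : Lam := mon K fset0.

Lemma gr_one : gr false one.
Proof. by have := @gr_mon fset0; rewrite /parity cardfs0. Qed.

Lemma D_one j : Dl j one = 0.
Proof. by rewrite /Dl /one /= dop_mon /derB in_fset0. Qed.

Lemma V_one m : Vl m one = 0.
Proof. exact: (v_eq0 pivot_pvn _ D_one). Qed.

Lemma xs_oneE s : uniq s ->
  exists e : nat, xs Xl s one = (-1) ^+ e *: mon K [fset x in s].
Proof.
elim: s => [_|i s IH /= /andP[si us]].
  exists 0%N; rewrite scale1r /one; congr (mon K _).
  by apply/fsetP => x; rewrite !inE.
have [e ->] := IH us; rewrite linearZ /= xop_mon /lmulB inE (negbTE si).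
exists (e + count (fun j => (j < i)%N) ([fset x in s] : seq nat))%N.
rewrite scalerA /sgnb -exprD; congr (_ *: mon K _).
by apply/fsetP => x; rewrite !inE.
Qed.

Lemma xs_one s : uniq s -> xs Xl s one <> 0.
Proof.
move=> /xs_oneE[e ->] /(congr1 (mcoeff [fset x in s])).
rewrite mcoeffZ mcoeff0 /mon mcoeffUU mulr1 => /eqP.
by rewrite signr_eq0.
Qed.

Lemma mon_xs S : exists e : nat, mon K S = (-1) ^+ e *: xs Xl S one.
Proof.
have [e He] := xs_oneE (fset_uniq S); exists e.
rewrite He scalerA -expr2 sqrr_sign scale1r; congr (mon K _).
by apply/fsetP => x; rewrite !inE.
Qed.

Lemma op_ext a : linear a -> (forall s, a (xs Xl s one) = 0) -> forall f, a f = 0.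
Proof.
move=> la a0.
pose A := HB.pack_for {linear Lam -> Lam} a (GRing.isLinear.Build K Lam Lam _ a la).
apply: (linear_mon (a := A) (b := \0)) => S /=.
by have [e ->] := mon_xs S; rewrite -[a]/(A : Lam -> Lam) linearZ /= a0 scaler0.
Qed.

Lemma pivot_rec m f : Vl m f = Dl m f + Xl m (Xl m.+1 (Vl m.+3 f)).
Proof. exact: (v_rec pivot_pvn). Qed.

Lemma pivot_xop m j f : (j < m)%N -> Vl m (Xl j f) = - Xl j (Vl m f).
Proof. exact: (v_X pivot_pvn xop_anti dop_xop_neq). Qed.

Lemma pivot_dop m j f : (j < m)%N -> Vl m (Dl j f) = - Dl j (Vl m f).
Proof. exact: (v_D pivot_pvn dop_xop_neq dop_anti). Qed.

(** * Homogeneous decomposition of the elements of Q *)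

Notation WL := (W Xl Vl).
Notation moL := (mo Xl Vl).
Notation homL := (hom gr).

Lemma W_supbr p q a b : WL p a -> WL q b -> WL (p (+) q) (supbr p q a b).
Proof.
exact: (W_br xop_anti xop_sq dop_xop dop_xop_neq dop_sq pivot_rec
  pivot_xop pivot_dop).
Qed.

Lemma W_opsq a : WL true a -> WL false (opsq a).
Proof.
exact: (W_sq xop_anti xop_sq dop_xop dop_xop_neq dop_sq pivot_rec
  pivot_xop pivot_dop).
Qed.

Lemma W_hom_gr p a : WL p a -> homL p a.
Proof. exact: (W_hom gr0 grD grZ gr_X gr_V). Qed.

Lemma hom_homog p a : homL p a -> homog p a.
Proof. by move=> ha S T; apply: gr_msupp; apply: ha; apply: gr_mon. Qed.

(** The predicate [homog] tests monomials only; linearity extends it to whole graded parts. *)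
Lemma homog_hom p a : linear a -> homog p a -> homL p a.
Proof.
move=> la ha q f qf.
pose A := HB.pack_for {linear Lam -> Lam} a (GRing.isLinear.Build K Lam Lam _ a la).
rewrite [f]monE -[a]/(A : Lam -> Lam) linear_sum; apply: gr_sum => S Sf _.
rewrite linearZ /=; apply: grZ => T qT; apply/eqP; rewrite mcoeff_eq0.
by apply: contra qT => /ha ->; rewrite (gr_msupp qf Sf).
Qed.

Definition graded_W a := exists b : bool -> Op,
  [/\ WL false (b false), WL true (b true) & a = opadd (b false) (b true)].

Lemma W_graded p a : WL p a -> graded_W a.
Proof.
move=> Wa; exists (fun q => if q == p then a else opzero (K := K)).
case: p Wa => Wa; split=> //=; try exact: span0.
  by apply: functional_extensionality => f; rewrite /opadd /opzero add0r.
by apply: functional_extensionality => f; rewrite /opadd /opzero addr0.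
Qed.

Lemma graded_linear a : graded_W a -> linear a.
Proof.
move=> [b [W0 W1 ->]] c f g; rewrite /opadd (W_linear W0) (W_linear W1).
by rewrite scalerDr addrACA.
Qed.

(** Bracket operands in [inQ] are only known to be homogeneous; by [W_hom0] their component of the
    other parity vanishes, so closure of [W] applies to them. *)
Lemma graded_homog p a : graded_W a -> homog p a -> WL p a.
Proof.
move=> Wa /(homog_hom (graded_linear Wa)); case: Wa => b [W0 W1 ->].
have key q c d : WL q c -> WL (~~ q) d -> homL q (opadd c d) -> WL q (opadd c d).
  move=> Wc Wd hcd.
  have d0 := W_hom0 gr0 grD grZ gr_disj gr_X gr_V gr_one op_ext Wc Wd hcd.
  by apply: span_eq Wc => f; rewrite /opadd d0 addr0.
have -> : opadd (b false) (b true) = opadd (b p) (b (~~ p)).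
  by case: p => //; apply: functional_extensionality => f; rewrite /opadd addrC.
by case: p; apply: key.
Qed.

Lemma inQ_graded a : inQ a -> graded_W a.
Proof.
elim=> {a} [i _||a b _ [u [U0 U1 ->]] _ [w [W0 W1 ->]]|c a _ [u [U0 U1 ->]]
           |p q a b _ Wa _ Wb pa qb|a _ Wa pa].
- by apply: (W_graded (p := true)); apply: (@W_gen1 K _ Xl Vl true [::] i).
- by apply: (W_graded (p := true)); apply: span0.
- exists (fun p => opadd (u p) (w p)); split; [exact: spanD | exact: spanD | ].
  by apply: functional_extensionality => f; rewrite /opadd addrACA.
- exists (fun p => opscale c (u p)); split; [exact: spanZ | exact: spanZ | ].
  by apply: functional_extensionality => f; rewrite /opadd /opscale scalerDr.
- exact: W_graded (W_supbr (graded_homog Wa pa) (graded_homog Wb qb)).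
exact: W_graded (W_opsq (graded_homog Wa pa)).
Qed.

Lemma inQ_absorbing : absorbing gr (@inQ K) (@inQ K).
Proof.
split=> [|c a|p r q a Qq Qa hq ha]; [exact: inQ_zero | exact: inQ_scale | ].
by apply: inQ_br => //; apply: hom_homog.
Qed.

Lemma inQ_gen0 m : (m < 3)%N -> inQ (moL [::] m).
Proof. exact: inQ_gen. Qed.

Lemma inQ_sq0 a : inQ a -> homL true a -> inQ (fun f => a (a f)).
Proof. by move=> Qa /hom_homog; apply: inQ_sq. Qed.

Lemma inQ_pivot m : inQ (@pivot K m).
Proof.
exact: (Q_V xop_anti xop_sq dop_xop dop_xop_neq dop_sq pivot_rec
  pivot_xop pivot_dop gr_X gr_V
  inQ_absorbing inQ_gen0 inQ_sq0).
Qed.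

Lemma X_coef0 i f : (Xl i f)@_fset0 = 0.
Proof.
rewrite /Xl /= /xop /linext raddf_sum big1 => [//|S _] /=.
rewrite mcoeffZ /lmulB; case: ifP => _; first by rewrite mcoeff0 mulr0.
rewrite mcoeffZ /mon mcoeffU; case: eqP => [e|_]; last by rewrite !mulr0.
by have := fset1U1 i S; rewrite e in_fset0.
Qed.

(** Only d_i produces a constant term, as the rest of v_i starts with x_i. Thus the pivots are dual
    to the generators, hence independent. *)
Lemma V_X_coef0 i j : (Vl i (Xl j one))@_fset0 = (i == j)%:R.
Proof.
rewrite pivot_rec mcoeffD [X in _ + X]X_coef0 addr0; case: eqP => [->|/eqP ij].
  by rewrite dop_xop mcoeffB [X in _ - X]X_coef0 subr0 /one /mon mcoeffUU.
by rewrite dop_xop_neq // mcoeffN [X in - X]X_coef0 oppr0.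
Qed.

Lemma mcoeff_lincomb n (c : 'I_n -> K) (b : 'I_n -> Op) f T :
  (lincomb c b f)@_T = \sum_(j < n) c j * (b j f)@_T.
Proof.
rewrite /lincomb (big_morph (mcoeff T) (mcoeffD T) (mcoeff0 T)).
by apply: eq_bigr => j _; rewrite mcoeffZ.
Qed.

Lemma Q_infinite : Q_infinite_dim K.
Proof.
move=> n; exists (fun j : 'I_n => @pivot K j); split=> [j|c c0 j]; first exact: inQ_pivot.
have := mcoeff_lincomb c (fun j : 'I_n => @pivot K j) (Xl j one) fset0.
rewrite c0 mcoeff0 (eq_bigr (fun i : 'I_n => c i * (i == j)%:R)) => [|i _]; last first.
  by congr (_ * _); apply: V_X_coef0.
rewrite (bigD1 j) //= big1 => [|i ij]; first by rewrite eqxx mulr1 addr0.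
by move: ij; rewrite -val_eqE => /negbTE ->; rewrite mulr0.
Qed.

(** * Parity components of ideals and finite codimension *)

Lemma projE p f : proj p f = linext (fun S => if parity S == p then mon K S else 0) f.
Proof.
rewrite /proj /linext big_mkcond; apply: eq_bigr => S _.
by case: ifP => // _; rewrite scaler0.
Qed.

Lemma proj_add p f g : proj p (f + g) = proj p f + proj p g.
Proof.
rewrite !projE -[f]scale1r linext_is_linear scale1r.
by rewrite scale1r.
Qed.

Lemma gr_proj p f : gr p (proj p f).
Proof. by apply: gr_sum => S _ /eqP <-; apply/grZ/gr_mon. Qed.

Lemma proj_id p f : gr p f -> proj p f = f.
Proof.
move=> pf; rewrite [RHS]monE /proj big_seq_cond [RHS]big_seq.
apply: eq_bigl => S; case: (boolP (S \in msupp f)) => //= /(gr_msupp pf) ->.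
by rewrite eqxx.
Qed.

Lemma proj_eq0 p f : gr (~~ p) f -> proj p f = 0.
Proof.
move=> pf; rewrite /proj big_seq_cond big_pred0 // => S.
by case: (boolP (S \in msupp f)) => //= /(gr_msupp pf) ->; case: (p).
Qed.

Lemma proj_sum f : proj false f + proj true f = f.
Proof.
rewrite [RHS]monE /proj [RHS](bigID (fun S => parity S == false)) /=; congr (_ + _).
by apply: eq_bigl => S; case: parity.
Qed.

(** On each graded part of the algebra b p and b (~~ p) land in opposite parities, so the
    projections in [part] select b p. An ideal thus contains the components of its elements. *)
Lemma part_graded p (b : bool -> Op) : WL false (b false) -> WL true (b true) ->
  part p (opadd (b false) (b true)) = b p.
Proof.
move=> W0 W1; apply: functional_extensionality => f.
have Wb q : WL q (b q) by case: q.
have key q : proj (q (+) p) (opadd (b false) (b true) (proj q f)) = b p (proj q f).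
  have -> : opadd (b false) (b true) (proj q f) = b p (proj q f) + b (~~ p) (proj q f).
    by rewrite /opadd; case: (p) => //; rewrite addrC.
  rewrite proj_add [X in X + _]proj_id; last by apply: (W_hom_gr (Wb p)); apply: gr_proj.
  rewrite [X in _ + X]proj_eq0; first by rewrite addr0.
  by rewrite -addbN; apply: (W_hom_gr (Wb (~~ p))); apply: gr_proj.
rewrite /part [X in X + _](key false) [X in _ + X](key true) -[in RHS](proj_sum f).
rewrite -[proj false f in RHS]scale1r (W_linear (Wb p)).
by rewrite scale1r.
Qed.

Lemma bnd_finite N : exists n (b : 'I_n -> Op), forall p a,
  span (bnd Xl Vl N p) a -> exists c, a = lincomb c b.
Proof.
(* A word with a repeated letter acts as zero; any other word on letters below N has length at most
   N. *)
pose T := ('I_N * {bseq N of 'I_N})%type.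
pose e (x : T) := moL (map val (x.2 : seq 'I_N)) x.1.
exists #|{: T}|, (fun j : 'I_#|{: T}| => e (enum_val j)) => p a.
elim=> [|c g a' [s [m [sN mN _ ->]]] _ [d ->]].
  exists (fun=> 0); apply: functional_extensionality => f.
  by rewrite /lincomb big1 // => j _; rewrite scale0r.
have [us|us] := boolP (uniq s); last first.
  exists d; apply: functional_extensionality => f.
  by rewrite /mo (xs_nuniq xop_anti xop_sq) // scaler0 add0r.
have [s' ss'] : exists s' : seq 'I_N, map val s' = s.
  elim: s sN {us} => [|i s IH] /=; first by exists [::].
  by case/andP=> iN /IH[s' <-]; exists (Ordinal iN :: s').
have size_s : (size s' <= N)%N.
  rewrite -(size_map val) ss' -[N in (_ <= N)%N](size_iota 0).
  rewrite uniq_leq_size // => x /(allP sN).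
  by rewrite mem_iota.
pose x : T := (Ordinal mN, Bseq size_s).
exists (fun j : 'I_#|{: T}| => d j + (if j == enum_rank x then c else 0)).
apply: functional_extensionality => f; rewrite /lincomb addrC.
under [RHS]eq_bigr do rewrite scalerDl.
rewrite big_split; congr (_ + _); rewrite (bigD1 (enum_rank x)) //= eqxx.
rewrite big1 => [|j /negbTE ->]; last by rewrite scale0r.
by rewrite addr0 enum_rankK /e /= ss'.
Qed.

Lemma lincombD n (c d : 'I_n -> K) (b : 'I_n -> Op) f :
  lincomb c b f + lincomb d b f = lincomb (fun j : 'I_n => c j + d j) b f.
Proof.
by rewrite /lincomb -big_split; apply: eq_bigr => j _; rewrite scalerDl.
Qed.

Lemma ideal_finite_codim (I : Op -> Prop) : Q_ideal I ->
  (exists a, I a /\ a <> @opzero K) -> finite_codim I.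
Proof.
move=> [IQ [I0 [ID [IZ [Ipart [IB Isq]]]]]] [a [Ia a0]].
have I_abs : absorbing gr (@inQ K) I.
  split=> [|c b|p r q b Qq Ib hq hb]; [exact: I0 | exact: IZ | ].
  by apply: IB => //; apply: hom_homog.
have I_sq b : I b -> homL true b -> I (fun f => b (b f)).
  by move=> Ib /hom_homog; apply: Isq.
have [b [W0 W1 ab]] := inQ_graded (IQ _ Ia).
have Ib p : I (b p) by rewrite -(part_graded p W0 W1) -ab; apply: Ipart.
(* One of the two homogeneous components of a is nonzero, and it lies in I. *)
have [p [f bf]] : exists p f, b p f <> 0.
  apply: NNPP => h; apply: a0; rewrite ab; apply: functional_extensionality => f.
  have b0 p : b p f = 0 by apply: NNPP => bf; apply: h; exists p, f.
  by rewrite /opadd !b0 addr0.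
have Wb : WL p (b p) by case: p {bf}.
have [M IM] := ideal_V xop_anti xop_sq dop_xop dop_xop_neq dop_sq pivot_rec
  pivot_xop pivot_dop
  gr0 grD grZ gr_X gr_V V_one xs_one op_ext inQ_absorbing inQ_gen0 inQ_sq0
  I_abs (Ib p) Wb (ex_intro _ f bf).
have [n [e He]] := bnd_finite (M + 20).
have tail q c : WL q c -> exists u d, I u /\ forall h, c h = u h + lincomb d e h.
  move=> /(ideal_tail xop_anti xop_sq dop_xop dop_xop_neq dop_sq pivot_rec
  pivot_xop pivot_dop
    gr_X gr_V inQ_absorbing inQ_gen0 inQ_sq0 I_abs ID I_sq IM)[u [d [Iu /He[x ->] cE]]].
  by exists u, x.
exists n, e => q /inQ_graded[c [C0 C1 ->]].
have [u [d [Iu cE]]] := tail _ _ C0; have [u' [d' [Iu' cE']]] := tail _ _ C1.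
exists (fun j : 'I_n => d j + d' j), (opadd u u'); split; first exact: ID.
apply: functional_extensionality => h.
by rewrite /opadd cE cE' addrACA lincombD.
Qed.

End Grassmann.

Theorem theorem7p4 (K : fieldType) :
  Q_infinite_dim K /\
  (forall I : Op K -> Prop, Q_ideal I ->
     (exists a, I a /\ a <> @opzero K) -> finite_codim I).
Proof. by split; [apply: Q_infinite | apply: ideal_finite_codim]. Qed.
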